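(* Let $f\in\Lambda_1(\mathbb{R}^d)$. Let $p\in\mathbb{N}$, $a_1,\dots,a_p\in\mathbb{R}^d$ and $\mu_1,\dots,\mu_p\in\mathbb{R}$ be such that $\sum_{i=1}^p\mu_i=0$ and $\sum_{i=1}^p\mu_ia_i=0$. Define $$\Omega_\varepsilon f(x):=\int_\varepsilon^1\frac{\sum_{i=1}^p\mu_i f(x+a_ih)}{h}\,\frac{dh}{h},\qquad x\in\mathbb{R}^d.$$ Then there exists a positive constant $C$ depending only on $d$, $a_1,\dots,a_p$, $\mu_1,\dots,\mu_p$ and $\|f\|_1$ such that $$\limsup_{\varepsilon\to0}\frac{|\Omega_\varepsilon f(x)|}{\sqrt{\log(1/\varepsilon)\,\log\log\log(1/\varepsilon)}}\leq C$$ for almost all $x\in\mathbb{R}^d$ (with respect to Lebesgue measure).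
   Context: $\Lambda_1(\mathbb{R}^d)$ is the Zygmund class: all continuous functions $f:\mathbb{R}^d\to\mathbb{R}$ with $\|f\|_1:=\sup\frac{|f(x+h)+f(x-h)-2f(x)|}{|h|}<\infty$, the supremum being over all $x\in\mathbb{R}^d$ and $h\in\mathbb{R}^d\setminus\{0\}$ (so $\|f\|_1$ is not the $L^1$ norm). *)

(* Defs.v *)
From HB Require Import structures.
From mathcomp Require Import all_boot all_order all_algebra.
From mathcomp Require Import all_classical all_reals all_analysis.

Set Implicit Arguments.
Unset Strict Implicit.
Unset Printing Implicit Defensive.

Import Order.TTheory GRing.Theory Num.Theory.
Import numFieldNormedType.Exports.

Local Open Scope classical_set_scope.
Local Open Scope ring_scope.

(* Points of the d-dimensional space are row vectors ['rV[R]_d]. Their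
   topology is the product topology, but the library norm [`|v|] on them is
   the sup norm, hence [enorm]. *)
Definition enorm (R : realType) (d : nat) (v : 'rV[R]_d) : R :=
  Num.sqrt (\sum_(i < d) v ord0 i ^+ 2).

Section lebesgue_measure_rV.
Context (R : realType) (d : nat).

Definition box (ab : 'rV[R]_d.+1 * 'rV[R]_d.+1) : set 'rV[R]_d.+1 :=
  [set x | forall i, ab.1 ord0 i < x ord0 i < ab.2 ord0 i].

(* The truncation at 0 gives volume 0 to the empty boxes. *)
Definition box_volume (ab : 'rV[R]_d.+1 * 'rV[R]_d.+1) : R :=
  \prod_(i < d.+1) Num.max 0 (ab.2 ord0 i - ab.1 ord0 i).

Definition box_cover (X : set 'rV[R]_d.+1) :
    set (nat -> 'rV[R]_d.+1 * 'rV[R]_d.+1) :=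
  [set I | X `<=` \bigcup_k box (I k)].

(* The dimension is d.+1: in dimension 0 the only box is a point of volume 1,
   and a sequence of boxes could not cover the empty set at no cost. *)
Definition lebesgue_outer (X : set 'rV[R]_d.+1) : \bar R :=
  ereal_inf [set (\sum_(k <oo) (box_volume (I k))%:E)%E | I in box_cover X].

Local Open Scope ereal_scope.

Let vol_ge0 ab : 0 <= (box_volume ab)%:E.
Proof. by rewrite lee_fin prodr_ge0// => i _; rewrite le_max lexx. Qed.

Let vol_series_ge0 (I : nat -> 'rV[R]_d.+1 * 'rV[R]_d.+1) :
  0 <= \sum_(k <oo) (box_volume (I k))%:E.
Proof. by apply: nneseries_ge0 => *; exact: vol_ge0. Qed.

Lemma lebesgue_outer_ge0 X : 0 <= lebesgue_outer X.
Proof. by apply: le_ereal_inf_tmp => _ [I _ <-]. Qed.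

Lemma le_lebesgue_outer :
  {homo lebesgue_outer : A B / A `<=` B >-> A <= B}.
Proof.
move=> A B AB; apply/ereal_inf_le_tmp => _ [I BI <-].
by exists I => //; exact: subset_trans AB BI.
Qed.

Lemma lebesgue_outer0 : lebesgue_outer set0 = 0.
Proof.
apply/eqP; rewrite eq_le lebesgue_outer_ge0 andbT.
apply: ereal_inf_lbound; exists (fun=> (0, 0)%R); first exact: sub0set.
apply: eseries0 => k _ _; congr EFin.
by rewrite /box_volume big_ord_recl /= !mxE subrr maxxx mul0r.
Qed.

Lemma lebesgue_outer_sigma_subadditive : sigma_subadditive lebesgue_outer.
Proof.
move=> A; have [[i ioo]|] := pselect (exists i, lebesgue_outer (A i) = +oo).
  rewrite (eseries_pinfty _ _ ioo) ?leey// => n _.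
  by rewrite -ltNye (lt_le_trans _ (lebesgue_outer_ge0 _)).
rewrite -forallNE => Aoo.
suff add2e (e : {posnum R}) : lebesgue_outer (\bigcup_n A n) <=
    \sum_(i <oo) lebesgue_outer (A i) + e%:num%:E.
  by apply/lee_addgt0Pr => _/posnumP[].
rewrite (le_trans _ (epsilon_trick _ _ _))//; last first.
  by move=> n; exact: lebesgue_outer_ge0.
pose v ab := (box_volume ab)%:E.
pose P n (B : nat -> 'rV[R]_d.+1 * 'rV[R]_d.+1) := box_cover (A n) B /\
  \sum_(k <oo) v (B k) <= lebesgue_outer (A n) + (e%:num / (2 ^ n.+1)%:R)%:E.
have [G PG] : {G & forall n, P n (G n)}.
  apply: (@choice _ _ P) => n; rewrite /P /lebesgue_outer.
  set S := (X in ereal_inf X); move infS : (ereal_inf S) => iS.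
  case: iS infS => [r Sr|Soo|Soo].
  - have en1 : (0 < e%:num / (2 ^ n.+1)%:R)%R by [].
    have /(lb_ereal_inf_adherent en1) : ereal_inf S \is a fin_num by rewrite Sr.
    move=> [x [B AnB vBx] xS].
    by exists B; split => //; rewrite vBx -Sr; exact/ltW.
  - by have := Aoo n; rewrite /lebesgue_outer Soo.
  - suff : lbound S 0 by move/le_ereal_inf_tmp; rewrite Soo.
    by move=> /= _ [B AnB <-].
have vG_ge0 x : 0 <= (v \o uncurry G) x by exact: vol_ge0.
apply: (@le_trans _ _ (\esum_(i in setT) (v \o uncurry G) i)).
  rewrite /lebesgue_outer; apply: ereal_inf_lbound => /=.
  have /card_esym/ppcard_eqP[f] := card_nat2.
  exists (uncurry G \o f).
    move=> t [i _ /(PG i).1 [j _ Bijt]].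
    by exists (f^-1%FUN (i, j)) => //=; rewrite invK ?inE.
  rewrite -(esum_pred_image (v \o uncurry G) _ xpredT) ?[fun=> _]set_true//.
  by rewrite image_eq.
rewrite (_ : esum _ _ = \sum_(i <oo) \sum_(j <oo ) v (G i j)); last first.
  pose J : nat -> set (nat * nat) := fun i => [set (i, j) | j in setT].
  rewrite (_ : setT = \bigcup_k J k); last first.
    by rewrite predeqE => -[a b]; split => // _; exists a => //; exists b.
  rewrite esum_bigcupT /=; last 2 first.
    - apply/trivIsetP => i j _ _ ij.
      rewrite predeqE => -[n m] /=; split => //= -[] [_] _ [<-{n} _].
      by move=> [m' _] [] /esym/eqP; rewrite (negbTE ij).
    - by move=> nm; exact: vG_ge0.
  rewrite -(image_id [set: nat]) -fun_true esum_pred_image//; last first.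
    by move=> n _; apply: esum_ge0 => m _; exact: vG_ge0.
  apply: eq_eseriesr => /= j _.
  rewrite -(esum_pred_image (v \o uncurry G) (pair j) predT)//=; last first.
  - by move=> ? ? _ _; exact: (@can_inj _ _ _ snd).
  - by move=> ? _; exact: (vG_ge0 (_, _)).
  - by congr esum; rewrite predeqE => -[? ?]; split; move=> [i _ <-]; exists i.
apply: lee_lim.
- apply: is_cvg_nneseries => n *.
  by apply: nneseries_ge0 => m *; exact: (vG_ge0 (n, m)).
- apply: is_cvg_nneseries => n *.
  by apply: adde_ge0 => //; exact: lebesgue_outer_ge0.
- by near=> n; apply: lee_sum => i _; exact: (PG i).2.
Unshelve. all: by end_near. Qed.

HB.instance Definition _ := isOuterMeasure.Build R 'rV[R]_d.+1 lebesgue_outer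
  lebesgue_outer0 lebesgue_outer_ge0 le_lebesgue_outer
  lebesgue_outer_sigma_subadditive.

(* Lebesgue measure is the restriction of [lebesgue_outer] to its
   Caratheodory-measurable sets, the measurable sets of
   [caratheodory_type lebesgue_outer], a copy of ['rV[R]_d.+1]. *)
Definition lebesgue_measure_rV :
    set (caratheodory_type lebesgue_outer) -> \bar R := lebesgue_outer.

HB.instance Definition _ := isMeasure.Build _ _ _ lebesgue_measure_rV
  (@caratheodory_measure0 _ _ lebesgue_outer)
  (@caratheodory_measure_ge0 _ _ lebesgue_outer)
  (@caratheodory_measure_sigma_additive _ _ lebesgue_outer).

End lebesgue_measure_rV.
Arguments lebesgue_measure_rV : clear implicits.

Section zygmund.
Context (R : realType) (d : nat).
Implicit Types f : 'rV[R]_d.+1 -> R.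

Definition zygmund_norm f : \bar R :=
  ereal_sup [set (`|f (x + h) + f (x - h) - 2 * f x| / enorm h)%:E
            | x in setT & h in [set h | h != 0]].

Definition zygmund_class : set ('rV[R]_d.+1 -> R) :=
  [set f | continuous f /\ (zygmund_norm f < +oo)%E].

Definition Omega (p : nat) (a : 'I_p -> 'rV[R]_d.+1) (mu : 'I_p -> R) f
    (eps : R) (x : 'rV[R]_d.+1) : R :=
  \int[lebesgue_measure]_(h in `[eps, 1])
    ((\sum_(i < p) mu i * f (x + h *: a i)) / h / h).

End zygmund.

(* Main.v *)
Require Import Defs.
From mathcomp Require Import all_boot all_order all_algebra.
From mathcomp Require Import all_classical all_reals all_analysis.
From mathcomp Require Import ring lra zify.

Set Implicit Arguments.
Unset Strict Implicit.
Unset Printing Implicit Defensive.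

Import Order.TTheory GRing.Theory Num.Theory.
Import numFieldNormedType.Exports.

Local Open Scope classical_set_scope.
Local Open Scope ring_scope.

(** Write S_m for [Omega] truncated at 2 ^- m. The theorem holds because (S_m)
    is, up to bounded errors, a dyadic martingale with bounded increments, and
    such martingales obey the law of the iterated logarithm.

    Regularity. The Zygmund condition forces every mixed difference of [f] with
    sides w and z to be O(sqrt (|w| |z|)) ([cross_zygmund]). Since the mu i sum
    to 0, this makes S_m vary by O(1) over distances 2 ^- m. Moreover a function
    with second differences at most eta on a ball is within O(eta) of an affine
    function there ([balanced_sum_le]), and the stencil of the a i and mu i
    annihilates affine functions; so |S_(m+1) - S_m| = O(1).

    Cancellation. Averaging [f] over a cube of side s divides its second
    differences in a direction v by sqrt (s / |v|): in the average of an
    increment along v only boundary layers of the cube survive, and what is left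
    there is a mixed difference with sides of size |v| and s
    ([grid_mean_diff2]). Hence the scales h < s contribute O(1) in total to the
    average of any S_N over the cube ([grid_mean_Omega_itv]). Averages are taken
    over finite grids of spacing 2 ^- N, fine enough to see all scales of S_N.

    Consequently the averages of S_N over dyadic cubes form a finite martingale
    which at generation k is within a constant K of S_k
    ([Omega_martingale_approx]). Its maximal exponential inequality is proved by
    downward induction on the generation, directly for the outer measure of the
    exceptional set inside a cube ([maximal_tree]): either the cube is stopped,
    or the exceptional set splits among its children, where the convexity bound
    for the exponential applies.

    With N = 2 ^ k and the level C sqrt (2 ^ k ln k), the exceptional set of a
    unit cube has measure O(k ^ -2) ([lil_tail]); a Borel-Cantelli argument
    ([outer_limsup_null]) and comparison of sqrt (2 ^ k ln k) with the
    normalization of the theorem at 2 ^ k <= log2 (1 / eps) < 2 ^ k.+1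
    ([lil_limsup]) conclude. *)

(** * Mixed differences of Zygmund functions *)

Section second_differences.
Context (R : realType) (n : nat).
Local Notation V := 'rV[R]_n.+1.
Implicit Types (f : V -> R) (x y v w z : V) (M : R).

Definition diff2 f v x : R := f (x + v) + f (x - v) - 2 * f x.

Definition cross f w z y : R := f (y + w + z) - f (y + w) - f (y + z) + f y.

Definition zygmund_le f M := forall x v, `|diff2 f v x| <= M * `|v|.

Lemma crossC f w z y : cross f w z y = cross f z w y.
Proof. by rewrite /cross (addrAC y w z); ring. Qed.

(** The four points are the vertices of a parallelogram, whose two diagonals
    have the same midpoint. *)
Lemma cross_diff2 f w z y : let c := y + 2^-1 *: (w + z) in
  cross f w z y = diff2 f (2^-1 *: (w + z)) c - diff2 f (2^-1 *: (w - z)) c.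
Proof.
rewrite /cross /diff2 /=.
have -> : y + 2^-1 *: (w + z) + 2^-1 *: (w + z) = y + w + z
  by apply/rowP => i; rewrite !mxE; field.
have -> : y + 2^-1 *: (w + z) - 2^-1 *: (w + z) = y by rewrite addrK.
have -> : y + 2^-1 *: (w + z) + 2^-1 *: (w - z) = y + w
  by apply/rowP => i; rewrite !mxE; field.
have -> : y + 2^-1 *: (w + z) - 2^-1 *: (w - z) = y + z
  by apply/rowP => i; rewrite !mxE; field.
ring.
Qed.

Lemma cross_le f eta r w z y :
  (forall v x, `|v| <= r -> `|diff2 f v x| <= eta) -> `|w| + `|z| <= 2 * r ->
  `|cross f w z y| <= 2 * eta.
Proof.
move=> fe wz; rewrite cross_diff2 (le_trans (ler_normB _ _))//.
have h v : `|v| <= 2 * r -> `|2^-1 *: v| <= r.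
  by move=> vr; rewrite normrZ ger0_norm//; lra.
rewrite mulr_natl mulr2n lerD// fe// h// (le_trans _ wz)//.
- exact: ler_normD.
- exact: ler_normB.
Qed.

Lemma cross_zygmund_lin f M w z y : 0 <= M -> zygmund_le f M ->
  `|cross f w z y| <= M * (`|w| + `|z|).
Proof.
move=> M0 fM; rewrite cross_diff2 (le_trans (ler_normB _ _))//.
have h1 := fM (y + 2^-1 *: (w + z)) (2^-1 *: (w + z)).
have h2 := fM (y + 2^-1 *: (w + z)) (2^-1 *: (w - z)).
rewrite !normrZ (ger0_norm (_ : 0 <= 2^-1)) in h1 h2; try by rewrite invr_ge0.
have h3 : M * `|w + z| <= M * (`|w| + `|z|) by rewrite ler_wpM2l// ler_normD.
have h4 : M * `|w - z| <= M * (`|w| + `|z|) by rewrite ler_wpM2l// ler_normB.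
lra.
Qed.

(** The parallelogram with sides 2 w and z is cut into two with sides w and z,
    whose mixed differences differ by two second differences in direction w. *)
Lemma cross_halve f M w z y : zygmund_le f M ->
  `|cross f w z y| <= 2^-1 * `|cross f (2 *: w) z y| + M * `|w|.
Proof.
move=> fM.
have -> : cross f w z y = 2^-1 * cross f (2 *: w) z y -
    2^-1 * (diff2 f w (y + w + z) - diff2 f w (y + w)).
  rewrite /cross /diff2.
  have -> : y + 2 *: w + z = y + w + z + w
    by apply/rowP => i; rewrite !mxE; ring.
  have -> : y + 2 *: w = y + w + w by apply/rowP => i; rewrite !mxE; ring.
  have -> : y + w + z - w = y + z by apply/rowP => i; rewrite !mxE; ring.
  have -> : y + w - w = y by rewrite addrK.
  by field.
rewrite (le_trans (ler_normB _ _))// !normrM (ger0_norm (_ : 0 <= 2^-1))//.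
rewrite lerD2l.
have h1 := fM (y + w + z) w; have h2 := fM (y + w) w.
have := ler_normB (diff2 f w (y + w + z)) (diff2 f w (y + w)).
lra.
Qed.

(** Doubling the shorter side until it reaches the longer one would give the
    sharper bound |w| (1 + log (|z| / |w|)). The square root is what the
    integrals over scales need, and it is reproduced by the induction because
    2 sqrt 2 + 1 <= 4. *)
Lemma cross_zygmund f M w z y : 0 <= M -> zygmund_le f M ->
  `|cross f w z y| <= 4 * M * Num.sqrt (`|w| * `|z|).
Proof.
move=> M0 fM.
wlog wz : w z y / `|w| <= `|z|.
  move=> H; have [|/ltW] := leP `|w| `|z|; first exact: H.
  by rewrite crossC (mulrC `|w|); exact: H.
have [w0|w_neq0] := eqVneq w 0.
  rewrite /cross w0 addr0 normr0 mul0r sqrtr0 mulr0.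
  by rewrite (_ : _ - _ - _ + _ = 0) ?normr0//; ring.
have [k] : exists k, `|z| <= 2 ^+ k * `|w|.
  have /Num.Theory.archi_boundP := divr_ge0 (normr_ge0 z) (normr_ge0 w).
  set k := Num.bound _ => hk; exists k.
  rewrite -ler_pdivrMr ?normr_gt0// (le_trans (ltW hk))//.
  by rewrite -natrX ler_nat ltnW// ltn_expl.
elim: k w wz w_neq0 => [|k IH] w wz w_neq0 zk.
- rewrite expr0 mul1r in zk; have w0 := normr_ge0 w.
  have wS : `|w| <= Num.sqrt (`|w| * `|z|).
    by rewrite -[leLHS]ger0_norm// -sqrtr_sqr ler_wsqrtr// expr2 ler_wpM2l.
  have := cross_zygmund_lin w z y M0 fM.
  have : M * (`|w| + `|z|) <= M * (4 * Num.sqrt (`|w| * `|z|)).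
    by rewrite ler_wpM2l//; lra.
  lra.
- have w0 : 0 < `|w| by rewrite normr_gt0.
  have wS : `|w| <= Num.sqrt (`|w| * `|z|).
    by rewrite -[leLHS]ger0_norm// -sqrtr_sqr ler_wsqrtr// expr2 ler_wpM2l.
  have [zw|zw] := leP `|z| (2 * `|w|).
    have := cross_zygmund_lin w z y M0 fM.
    have : M * (`|w| + `|z|) <= M * (4 * Num.sqrt (`|w| * `|z|)).
      by rewrite ler_wpM2l//; lra.
    lra.
  have w2 : `|2 *: w| = 2 * `|w| by rewrite normrZ ger0_norm.
  have /= := IH (2 *: w).
  rewrite w2 -(mulrA 2) sqrtrM// => /(_ (ltW zw)).
  rewrite scaler_eq0 pnatr_eq0/= => /(_ w_neq0).
  rewrite mulrCA mulrA -exprS => /(_ zk) h1.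
  have h2 := cross_halve w z y fM.
  have q2 : Num.sqrt 2 <= 3 / 2 :> R.
    by rewrite -(@ler_sqr _ (Num.sqrt 2)) ?nnegrE// ?divr_ge0// sqr_sqrtr//; lra.
  have h3 : M * `|w| <= M * Num.sqrt (`|w| * `|z|) by rewrite ler_wpM2l.
  have h4 : M * (Num.sqrt 2 * Num.sqrt (`|w| * `|z|)) <=
      M * (3 / 2 * Num.sqrt (`|w| * `|z|)).
    by rewrite ler_wpM2l// ler_wpM2r// sqrtr_ge0.
  lra.
Qed.
End second_differences.

(** * Affine approximation from second differences *)

Section affine_approximation.
Context (R : realType).

(** At a point t0 where |psi| is maximal, center at t0 a segment with one end at
    -A, 0 or A, where psi is small, and the other end in [-A, A]: the second
    difference bounds 2 |psi t0| by |psi t0| + O(eta). Telescoping over dyadic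
    points instead would add up an error eta at every step. *)
Lemma max_principle (psi : R -> R) (A eta : R) : 0 < A -> continuous psi ->
  psi 0 = 0 -> psi A = 0 ->
  (forall s u, `|u| <= A -> `|psi (s + u) + psi (s - u) - 2 * psi s| <= eta) ->
  forall t, `|t| <= A -> `|psi t| <= 2 * eta.
Proof.
move=> A0 cpsi psi0 psiA heta.
have cN : {within `[- A, A], continuous (fun t => `|psi t|)}.
  apply: continuous_subspaceT => t.
  by apply: cvg_norm; exact: cpsi.
have [|t0 t0A tmax] := EVT_max _ cN; first by lra.
have max t : - A <= t <= A -> `|psi t| <= `|psi t0|.
  by move=> tA; apply: tmax; rewrite in_itv.
move: t0A; rewrite in_itv/= => /andP[t0l t0r].
suff H : `|psi t0| <= 2 * eta.
  by move=> t; rewrite ler_norml => /max /le_trans; exact.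
have eta0 : 0 <= eta by apply: le_trans (heta 0 0 _); rewrite // normr0 ltW.
have psiNA : `|psi (- A)| <= eta.
  have hA : `|A| <= A by rewrite ger0_norm// ltW.
  by have := heta 0 A hA; rewrite add0r sub0r psiA psi0 mulr0 subr0 add0r.
have [h|h] := leP t0 (A / 2); first have [h'|h'] := leP (- (A / 2)) t0.
- have := heta t0 t0; rewrite subrr psi0 addr0.
  have : `|psi (t0 + t0)| <= `|psi t0| by apply: max; lra.
  have : `|t0| <= A by rewrite ler_norml; lra.
  move=> h1 h2 /(_ h1); move: h2; rewrite !ler_norml.
  have [p0|p0] := leP 0 (psi t0).
    by rewrite ger0_norm//; lra.
  by rewrite ltr0_norm//; lra.
- have := heta t0 (t0 + A); rewrite (_ : t0 - (t0 + A) = - A); last by lra.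
  have : `|psi (t0 + (t0 + A))| <= `|psi t0| by apply: max; lra.
  have : `|t0 + A| <= A by rewrite ler_norml; lra.
  move=> h1 h2 /(_ h1); move: h2 psiNA; rewrite !ler_norml.
  have [p0|p0] := leP 0 (psi t0).
    by rewrite ger0_norm//; lra.
  by rewrite ltr0_norm//; lra.
- have := heta t0 (A - t0); rewrite (_ : t0 + (A - t0) = A); last by lra.
  rewrite psiA add0r.
  have : `|psi (t0 - (A - t0))| <= `|psi t0| by apply: max; lra.
  have : `|A - t0| <= A by rewrite ler_norml; lra.
  move=> h1 h2 /(_ h1); move: h2; rewrite !ler_norml.
  have [p0|p0] := leP 0 (psi t0).
    by rewrite ger0_norm//; lra.
  by rewrite ltr0_norm//; lra.
Qed.

Context (n : nat).
Local Notation V := 'rV[R]_n.+1.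
Implicit Types (G : V -> R) (v w x : V).

Lemma coord_le_norm x i : `|x ord0 i| <= `|x|.
Proof.
rewrite [leRHS]mx_normrE.
exact: (@le_bigmax _ _ _ 0 (fun ij => `|x ij.1 ij.2|) (ord0, i)).
Qed.

Lemma norm_le_coord x r : 0 <= r -> (forall i, `|x ord0 i| <= r) -> `|x| <= r.
Proof.
move=> r0 xr; rewrite [leLHS]mx_normrE; apply: bigmax_le => // -[i j] _ /=.
by rewrite (ord1 i).
Qed.

Lemma norm_delta_le (i : 'I_n.+1) : `|delta_mx ord0 i : V| <= 1.
Proof.
apply: norm_le_coord => // j; rewrite mxE eqxx/=.
by case: (_ == _); rewrite ?normr1 ?normr0.
Qed.

Lemma continuous_line G v w : continuous G -> continuous (fun t : R => G (v + t *: w)).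
Proof.
move=> cG t.
apply: continuous_comp; last exact: cG.
by apply: cvgD; [exact: cvg_cst|apply: cvgZr_tmp; exact: cvg_id].
Qed.

Lemma continuous_translate G v : continuous G -> continuous (fun x => G (x + v)).
Proof.
move=> cG x; apply: (@continuous_comp V V R (fun y => y + v) G); last exact: cG.
exact: (@cvgD R V V (nbhs x) (nbhs_filter x) id (cst v) _ _ cvg_id (cvg_cst _)).
Qed.

(** The maximum principle for the defect of G from its chord. *)
Lemma line_affine G (e : V) (A eta : R) : 0 < A -> `|e| <= 1 ->
  continuous G -> (forall v x, `|v| <= A -> `|diff2 G v x| <= eta) ->
  forall t, `|t| <= A ->
    `|G (t *: e) - G 0 - t / A * (G (A *: e) - G 0)| <= 2 * eta.
Proof.
move=> A0 e1 cG Geta.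
apply: (@max_principle (fun t => G (t *: e) - G 0 - t / A * (G (A *: e) - G 0))) => //.
- move=> t; apply: cvgB.
    apply: cvgB; last exact: cvg_cst.
    have := @continuous_line G 0 e cG t; under eq_fun do rewrite add0r.
    exact.
  apply: cvgMr_tmp; apply: cvgMr_tmp; exact: cvg_id.
- by rewrite scale0r subrr mul0r mul0r subrr.
- by rewrite divff ?gt_eqF// mul1r subrr.
move=> s u uA; have := Geta (u *: e) (s *: e).
rewrite /diff2 -scalerDl -scalerBl.
set X := G _; set Y := G _; set Z := G _.
move=> h; rewrite [E in `|E|](_ : _ = X + Y - 2 * Z); last first.
  by rewrite /X /Y /Z; field; rewrite gt_eqF.
apply: h; rewrite normrZ (le_trans _ uA)// ler_piMr//.
Qed.

Lemma sum_additive G (eta r : R) (I : Type) (s : seq I) (z : I -> V) :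
  (forall v x, `|v| <= r -> `|diff2 G v x| <= eta) ->
  \sum_(i <- s) `|z i| <= 2 * r ->
  `|G (\sum_(i <- s) z i) - G 0 - \sum_(i <- s) (G (z i) - G 0)| <=
    2 * (size s)%:R * eta.
Proof.
move=> Geta; elim: s => [|i s IH].
  by rewrite !big_nil subrr subr0 normr0 mulr0 mul0r.
rewrite !big_cons => h.
have h0 := normr_ge0 (z i).
have /IH IHs : \sum_(j <- s) `|z j| <= 2 * r by lra.
have hc := @cross_le _ _ G eta r (z i) (\sum_(j <- s) z j) 0 Geta.
rewrite /cross !add0r in hc.
have {}hc := hc (le_trans (lerD (lexx _) (ler_norm_sum _ _ _)) h).
rewrite /= -(natr1 (size s)).
set X := G (z i + _) in hc *; set Y := G (\sum_(j <- s) z j) in hc IHs *.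
set S := \sum_(j <- s) _ in IHs *.
rewrite (_ : X - _ - _ = (X - G (z i) - Y + G 0) + (Y - G 0 - S)); last by ring.
by apply: le_trans (ler_normD _ _) _; lra.
Qed.

(** Up to O(eta), G - G 0 is additive and is linear on each axis, so at the
    points a i it agrees with a linear form, which the stencil annihilates. *)
Lemma balanced_sum_le (p : nat) (a : 'I_p -> V) (mu : 'I_p -> R) G (eta : R) :
  \sum_(i < p) mu i = 0 -> \sum_(i < p) mu i *: a i = 0 -> continuous G ->
  (forall v x, `|v| <= n.+1%:R * (1 + \sum_(i < p) `|a i|) ->
     `|diff2 G v x| <= eta) ->
  `|\sum_(i < p) mu i * G (a i)| <= 4 * n.+1%:R * (\sum_(i < p) `|mu i|) * eta.
Proof.
move=> mu0 mua0 cG Geta.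
pose A := 1 + \sum_(i < p) `|a i|.
have A1 : 1 <= A by rewrite lerDl sumr_ge0.
have A0 : 0 < A by apply: lt_le_trans A1.
pose e j : V := delta_mx ord0 j.
pose L x := \sum_(j < n.+1) x ord0 j / A * (G (A *: e j) - G 0).
have aA i : `|a i| <= A.
  by rewrite /A (bigD1 i)//= addrCA lerDl addr_ge0// sumr_ge0.
have Ln i : `|G (a i) - G 0 - L (a i)| <= 4 * n.+1%:R * eta.
  have ae : a i = \sum_(j < n.+1) a i ord0 j *: e j by exact: row_sum_delta.
  pose S := \sum_(j < n.+1) (G (a i ord0 j *: e j) - G 0).
  rewrite (_ : G _ - _ - _ = (G (a i) - G 0 - S) + (S - L (a i))); last by ring.
  have h1 : `|G (a i) - G 0 - S| <= 2 * n.+1%:R * eta.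
    rewrite {1}ae /S.
    have := @sum_additive G eta (n.+1%:R * A) _ (index_enum 'I_n.+1)
      (fun j => a i ord0 j *: e j) Geta.
    rewrite [size _](_ : _ = n.+1); last by rewrite /index_enum -enumT size_enum_ord.
    apply; apply: (@le_trans _ _ (\sum_(j < n.+1) A)).
      apply: ler_sum => j _; rewrite normrZ (le_trans _ (aA i))//.
      by rewrite -[leRHS]mulr1 ler_pM// ?coord_le_norm// norm_delta_le.
    rewrite sumr_const card_ord -mulr_natl.
    have : 0 <= n.+1%:R * A by rewrite mulr_ge0// ltW.
    lra.
  have h2 : `|S - L (a i)| <= 2 * n.+1%:R * eta.
    rewrite -sumrB (le_trans (ler_norm_sum _ _ _))//.
    apply: (@le_trans _ _ (\sum_(j < n.+1) (2 * eta))); last first.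
      by rewrite sumr_const card_ord -mulr_natl; lra.
    apply: ler_sum => j _; apply: line_affine => //.
    - exact: norm_delta_le.
    - move=> v x vA; apply: Geta; rewrite (le_trans vA)// -/A.
      by rewrite ler_peMl ?ler1n// ltW.
    - by rewrite (le_trans _ (aA i))// coord_le_norm.
  by apply: le_trans (ler_normD _ _) _; lra.
have -> : \sum_(i < p) mu i * G (a i) =
    \sum_(i < p) mu i * (G (a i) - G 0 - L (a i)).
  under [RHS]eq_bigr do rewrite !mulrBr.
  rewrite !sumrB -mulr_suml mu0 mul0r subr0 [X in _ - X](_ : _ = 0) ?subr0//.
  rewrite /L; under eq_bigr do rewrite mulr_sumr.
  rewrite exchange_big/= big1// => j _.
  under eq_bigr do rewrite !mulrA.
  rewrite -!mulr_suml.
  have : (\sum_(i < p) mu i *: a i) ord0 j = 0 by rewrite mua0 mxE.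
  rewrite summxE; under eq_bigr do rewrite mxE.
  by move=> ->; rewrite !mul0r.
rewrite (le_trans (ler_norm_sum _ _ _))//.
rewrite mulrAC mulr_sumr; apply: ler_sum => i _.
by rewrite normrM mulrC ler_wpM2r.
Qed.

End affine_approximation.

(** * Averages over dyadic grids *)

Section dyadic_averages.
Context (R : realType) (n : nat).
Local Notation V := 'rV[R]_n.+1.
Implicit Types (f phi psi : V -> R) (v x y u : V) (s t h : R) (S : {set 'I_n.+1}).

(** The vertices of the unit cube, indexed by subsets of the axes. *)
Definition corner S : V := \row_j (j \in S)%:R.

Definition corner_mean h phi x : R :=
  (2 ^+ n.+1)^-1 * \sum_(S : {set 'I_n.+1}) phi (x + h *: corner S).

(** The average of phi over the grid of spacing s / 2 ^ r in the cube of side s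
    with lowest corner x. Defining it by recursion on the generation makes the
    martingale property a definitional equality. *)
Fixpoint grid_mean r s phi : V -> R :=
  if r is r'.+1 then corner_mean (s / 2) (grid_mean r' (s / 2) phi) else phi.

Lemma card_corners : #|{set 'I_n.+1}| = (2 ^ n.+1)%N.
Proof. by rewrite -cardsT -powersetT card_powerset cardsT card_ord. Qed.

Lemma corner_ge0_le1 S j : 0 <= corner S ord0 j <= 1.
Proof. by rewrite mxE; case: (_ \in _); rewrite lexx ler01. Qed.

Lemma norm_corner_le S : `|corner S| <= 1.
Proof.
by apply: norm_le_coord => // j; have /andP[? ?] := corner_ge0_le1 S j; rewrite ger0_norm.
Qed.

Lemma mean_cst (c : R) :
  (2 ^+ n.+1)^-1 * \sum_(S : {set 'I_n.+1}) c = c.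
Proof.
by rewrite sumr_const card_corners -[c *+ _]mulr_natl natrX mulKf//.
Qed.

Lemma corner_mean_dist h phi x (c B : R) :
  (forall S, `|phi (x + h *: corner S) - c| <= B) ->
  `|corner_mean h phi x - c| <= B.
Proof.
move=> hB; rewrite -[X in _ - X]mean_cst /corner_mean -mulrBr -sumrB normrM.
rewrite ger0_norm ?invr_ge0 ?exprn_ge0// -[leRHS]mean_cst ler_wpM2l//.
by rewrite (le_trans (ler_norm_sum _ _ _))// ler_sum.
Qed.

Lemma grid_mean_dist r s phi x (c B : R) : 0 <= s ->
  (forall y, `|y - x| <= s -> `|phi y - c| <= B) ->
  `|grid_mean r s phi x - c| <= B.
Proof.
elim: r s x => [|r IH] s x s0 h /=; first by apply: h; rewrite subrr normr0.
apply: corner_mean_dist => S; apply: IH; first by rewrite divr_ge0.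
move=> y yS; apply: h.
rewrite (_ : y - x = (y - (x + (s / 2) *: corner S)) + (s / 2) *: corner S); last first.
  by rewrite opprD addrA subrK.
rewrite (le_trans (ler_normD _ _))// normrZ ger0_norm ?divr_ge0//.
have : s / 2 * `|corner S| <= s / 2 by rewrite ler_piMr ?divr_ge0// norm_corner_le.
lra.
Qed.

Lemma grid_mean_le r s phi x (B : R) : (forall y, `|phi y| <= B) ->
  `|grid_mean r s phi x| <= B.
Proof.
move=> h; elim: r s x => [|r IH] s x //=.
by rewrite -[X in `|X|]subr0; apply: corner_mean_dist => S; rewrite subr0.
Qed.

Lemma grid_mean_translate r s phi u x :
  grid_mean r s (fun y => phi (y + u)) x = grid_mean r s phi (x + u).
Proof.
elim: r s x => [|r IH] s x //=.
by congr (_ * _); apply: eq_bigr => S _; rewrite IH addrAC.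
Qed.

Lemma grid_meanB r s phi psi x :
  grid_mean r s (fun y => phi y - psi y) x = grid_mean r s phi x - grid_mean r s psi x.
Proof.
elim: r s x => [|r IH] s x //=.
by rewrite /corner_mean -mulrBr -sumrB; under eq_bigr do rewrite IH.
Qed.

Lemma eq_grid_mean r s phi psi : phi =1 psi -> grid_mean r s phi =1 grid_mean r s psi.
Proof. by move=> /funext ->. Qed.

Lemma grid_mean_corner_mean r s h phi x :
  grid_mean r s (corner_mean h phi) x = corner_mean h (grid_mean r s phi) x.
Proof.
elim: r s x => [|r IH] s x //=.
rewrite /corner_mean; congr (_ * _).
under eq_bigr do rewrite IH /corner_mean mulr_sumr.
rewrite exchange_big/=; apply: eq_bigr => S _; rewrite mulr_sumr.
by apply: eq_bigr => S' _; rewrite addrAC.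
Qed.

Lemma grid_meanSr r s phi x :
  grid_mean r.+1 s phi x = grid_mean r (s / 2) (corner_mean (s / 2) phi) x.
Proof. by rewrite grid_mean_corner_mean. Qed.

Lemma sum_add_elem (i : 'I_n.+1) (F : {set 'I_n.+1} -> R) :
  \sum_S F S = \sum_(S : {set 'I_n.+1} | i \notin S) (F S + F (i |: S)).
Proof.
rewrite (bigID (fun S : {set 'I_n.+1} => i \in S))/= addrC big_split/=; congr (_ + _).
rewrite (reindex_onto (fun S => i |: S) (fun S => S :\ i)) /=; last first.
  by move=> S iS; rewrite finset.setD1K.
apply: eq_bigl => S; rewrite finset.setU11 /=.
apply/eqP/idP => [<-|iS]; last by rewrite finset.setU1K.
by rewrite !inE eqxx.
Qed.

Lemma corner_add (i : 'I_n.+1) S : i \notin S ->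
  corner (i |: S) = corner S + delta_mx ord0 i.
Proof.
move=> iS; apply/rowP => j; rewrite !mxE !inE eqxx /=.
have [->|ji] := eqVneq j i; first by rewrite (negbTE iS) add0r.
by rewrite addr0.
Qed.

(** Shifting by h along an axis moves one face of the cube of side h onto the
    opposite one, so only the increment by 2 h survives, and only for half of
    the vertices. *)
Lemma corner_mean_shift h psi (i : 'I_n.+1) (B : R) x :
  (forall y, `|psi (y + (2 * h) *: delta_mx ord0 i) - psi y| <= B) ->
  `|corner_mean h psi (x + h *: delta_mx ord0 i) - corner_mean h psi x| <= B / 2.
Proof.
move=> hB; rewrite /corner_mean -mulrBr -sumrB (sum_add_elem i).
rewrite normrM ger0_norm ?invr_ge0 ?exprn_ge0//.
rewrite -[leRHS]mean_cst (sum_add_elem i) ler_wpM2l ?invr_ge0 ?exprn_ge0//.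
rewrite (le_trans (ler_norm_sum _ _ _))//; apply: ler_sum => S iS.
rewrite -splitr corner_add//.
have -> : x + h *: delta_mx ord0 i + h *: (corner S + delta_mx ord0 i) =
   x + h *: corner S + (2 * h) *: delta_mx ord0 i.
  by apply/rowP => j; rewrite !mxE; ring.
have -> : x + h *: (corner S + delta_mx ord0 i) =
  x + h *: delta_mx ord0 i + h *: corner S by rewrite scalerDr addrAC addrA.
by rewrite addrCA [X in `|X|](_ : _ = psi (x + h *: corner S +
  (2 * h) *: delta_mx ord0 i) - psi (x + h *: corner S)) ?hB//; ring.
Qed.

Lemma corner_mean_shift_le h t psi (i : 'I_n.+1) (B : R) x :
  (forall y, `|psi (y + t *: delta_mx ord0 i) - psi y| <= B) ->
  `|corner_mean h psi (x + t *: delta_mx ord0 i) - corner_mean h psi x| <= B.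
Proof.
move=> hB; rewrite /corner_mean -mulrBr -sumrB.
rewrite normrM ger0_norm ?invr_ge0 ?exprn_ge0//.
rewrite -[leRHS]mean_cst ler_wpM2l ?invr_ge0 ?exprn_ge0//.
rewrite (le_trans (ler_norm_sum _ _ _))//; apply: ler_sum => S iS.
by rewrite addrAC.
Qed.

(** A shift by t of the cube changes a fraction t / s of it, and moves that part
    by s. The bound B1 pays for this, and B2 for the part of t finer than the
    grid. In the induction, averaging over the corners of the half cubes halves
    both s and B1. *)
Lemma grid_mean_shift r s psi (i : 'I_n.+1) (B1 B2 : R) : 0 < s ->
  (forall y, `|psi (y + s *: delta_mx ord0 i) - psi y| <= B1) ->
  (forall t y, 0 <= t <= s / 2 ^+ r -> `|psi (y + t *: delta_mx ord0 i) - psi y| <= B2) ->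
  forall t x, 0 <= t <= s ->
    `|grid_mean r s psi (x + t *: delta_mx ord0 i) - grid_mean r s psi x| <=
      t / s * B1 + B2.
Proof.
elim: r s psi B1 B2 => [|r IH] s psi B1 B2 s0 h1 h2 t x /andP[t0 ts].
  have B10 : 0 <= B1 by apply: le_trans (h1 0).
  rewrite /= (le_trans (h2 t x _)) ?expr0 ?divr1 ?t0// lerDr.
  by rewrite mulr_ge0 ?divr_ge0// ltW.
have s20 : 0 < s / 2 by rewrite divr_gt0.
have h1' y : `|corner_mean (s / 2) psi (y + (s / 2) *: delta_mx ord0 i) -
    corner_mean (s / 2) psi y| <= B1 / 2.
  apply: corner_mean_shift => z; rewrite (_ : 2 * (s / 2) = s) ?h1//.
  by rewrite mulrC divfK.
have h2' t' y : 0 <= t' <= s / 2 / 2 ^+ r ->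
    `|corner_mean (s / 2) psi (y + t' *: delta_mx ord0 i) -
    corner_mean (s / 2) psi y| <= B2.
  move=> ht'; apply: corner_mean_shift_le => z; apply: h2.
  by rewrite exprS invfM mulrA.
have {}IH := IH _ _ _ _ s20 h1' h2'.
rewrite !grid_meanSr.
set e := delta_mx ord0 i in h1 h2 h1' h2' IH *.
(* Beyond half of the cube, go through the shift by s / 2, for which the corner
   means telescope exactly. *)
have [t2|t2] := leP t (s / 2).
  have := IH t x; rewrite t0 t2 => /(_ isT).
  rewrite (_ : t / (s / 2) * (B1 / 2) = t / s * B1)//.
  by field; rewrite gt_eqF.
have := IH (t - s / 2) (x + (s / 2) *: e).
have -> : x + (s / 2) *: e + (t - s / 2) *: e = x + t *: e.
  by rewrite -addrA -scalerDl addrCA subrr addr0.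
have -> : 0 <= t - s / 2 <= s / 2 by apply/andP; split; lra.
rewrite (_ : (t - s / 2) / (s / 2) * (B1 / 2) = t / s * B1 - B1 / 2); last first.
  by field; rewrite gt_eqF.
have := @grid_mean_le r (s / 2) (fun y => corner_mean (s / 2) psi (y + (s / 2) *: e) -
    corner_mean (s / 2) psi y) x _ h1'.
rewrite grid_meanB grid_mean_translate.
set X := grid_mean _ _ _ _; set Y := grid_mean _ _ _ _; set Z := grid_mean _ _ _ _.
move=> k1 /(_ isT) k2; rewrite (_ : Z - Y = (Z - X) + (X - Y)); last by ring.
by rewrite (le_trans (ler_normD _ _))//; lra.
Qed.

Lemma increment_le_sum (G : V -> R) (I : Type) (l : seq I) (z : I -> V) (b : I -> R) :
  (forall i y, `|G (y + z i) - G y| <= b i) ->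
  forall y, `|G (y + \sum_(i <- l) z i) - G y| <= \sum_(i <- l) b i.
Proof.
move=> h; elim: l => [|i l IH] y; first by rewrite !big_nil addr0 subrr normr0.
rewrite !big_cons addrA.
have := IH (y + z i); have := h i y.
set X := G _; set Y := G _; set Z := G _ => h1 h2.
rewrite (_ : Z - Y = (Z - X) + (X - Y)); last by ring.
by rewrite (le_trans (ler_normD _ _))//; lra.
Qed.

(** With psi the increment of f by v, the second difference of the mean of f is
    an increment by v of the mean of psi. It is taken one axis at a time, and
    the increments of psi are mixed differences of f. *)
Lemma grid_mean_diff2 r s f (M : R) v x : 0 <= M -> zygmund_le f M -> 0 < s ->
  `|v| <= s ->
  `|diff2 (grid_mean r s f) v x| <= 4 * n.+1%:R * M *
     (`|v| / s * Num.sqrt (`|v| * s) + Num.sqrt (`|v| * (s / 2 ^+ r))).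
Proof.
move=> M0 fM s0 vs.
pose psi y := f (y + v) - f y.
have -> : diff2 (grid_mean r s f) v x =
    grid_mean r s psi (x - v + v) - grid_mean r s psi (x - v).
  by rewrite !grid_meanB !grid_mean_translate subrK /diff2; ring.
pose e j : V := delta_mx ord0 j.
pose b := `|v| / s * (4 * M * Num.sqrt (`|v| * s)) +
  4 * M * Num.sqrt (`|v| * (s / 2 ^+ r)).
have key t j y : 0 <= t -> `|psi (y + t *: e j) - psi y| <=
    4 * M * Num.sqrt (`|v| * t).
  move=> t0.
  rewrite (_ : _ - _ = cross f v (t *: e j) y); last first.
    by rewrite /psi /cross (addrAC y v); ring.
  apply: (le_trans (cross_zygmund _ _ _ _ fM)) => //.
  rewrite ler_wpM2l ?mulr_ge0// ler_wsqrtr// ler_wpM2l//.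
  by rewrite normrZ ger0_norm// ler_piMr// norm_delta_le.
have step t j y : 0 <= t <= `|v| ->
    `|grid_mean r s psi (y + t *: e j) - grid_mean r s psi y| <= b.
  move=> /andP[t0 tv].
  have h1 y' : `|psi (y' + s *: e j) - psi y'| <= 4 * M * Num.sqrt (`|v| * s).
    by apply: key; exact: ltW.
  have h2 t' y' : 0 <= t' <= s / 2 ^+ r ->
      `|psi (y' + t' *: e j) - psi y'| <= 4 * M * Num.sqrt (`|v| * (s / 2 ^+ r)).
    move=> /andP[t'0 t's]; apply: (le_trans (key _ _ _ t'0)).
    by rewrite ler_wpM2l ?mulr_ge0// ler_wsqrtr// ler_wpM2l.
  apply: (le_trans (grid_mean_shift s0 h1 h2 _ _)); first by rewrite t0 (le_trans tv).
  rewrite /b lerD2r ler_wpM2r ?mulr_ge0 ?sqrtr_ge0//.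
  by rewrite ler_pM2r ?invr_gt0.
have coord j y : `|grid_mean r s psi (y + v ord0 j *: e j) - grid_mean r s psi y| <= b.
  have [v0|v0] := leP 0 (v ord0 j).
    by apply: step; rewrite v0 (le_trans (ler_norm _))// coord_le_norm.
  have := step (- v ord0 j) j (y + v ord0 j *: e j).
  rewrite scaleNr addrK distrC; apply.
  by rewrite oppr_ge0 ltW// -(ltr0_norm v0) coord_le_norm.
have := @increment_le_sum (grid_mean r s psi) _ (index_enum 'I_n.+1)
  (fun j => v ord0 j *: e j) (fun=> b) coord (x - v).
rewrite -row_sum_delta => /le_trans; apply.
rewrite sumr_const card_ord -mulr_natl /b.
rewrite le_eqVlt; apply/orP; left; apply/eqP; ring.
Qed.

Lemma continuous_grid_mean r s f : continuous f -> continuous (grid_mean r s f).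
Proof.
move=> cf; elim: r s => [|r IH] s //=.
have cadd : continuous (fun z : R * R => z.1 + z.2) by exact: add_continuous.
have csum : continuous (fun y => \sum_(S : {set 'I_n.+1})
    grid_mean r (s / 2) f (y + (s / 2) *: corner S)).
  apply: (@continuous_big R _ +%R 0 xpredT cadd V _ (fun S y =>
    grid_mean r (s / 2) f (y + (s / 2) *: corner S))) => S _.
  exact: continuous_translate.
by move=> x; exact: cvgMl_tmp (csum x).
Qed.

Lemma zygmund_grid_mean r s f M : zygmund_le f M -> zygmund_le (grid_mean r s f) M.
Proof.
move=> fM x v.
have -> : diff2 (grid_mean r s f) v x = grid_mean r s (diff2 f v) x.
  pose g y := (f (y + v) - f y) - (f y - f (y - v)).
  rewrite (_ : diff2 f v = g); last by apply/funext => y; rewrite /diff2 /g; ring.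
  rewrite !grid_meanB !grid_mean_translate /diff2; ring.
by apply: grid_mean_le => y.
Qed.

End dyadic_averages.

(** * The truncated operator *)

Section integrals.
Context (R : realType).
Local Notation leb := (@lebesgue_measure R).
Implicit Types (lo hi t : R) (k b : R -> R).

(** The integrands are singular at 0, and are integrated over compact intervals
    of positive numbers. *)
Definition cont_pos k := forall t, 0 < t -> {for t, continuous k}.

Lemma cont_pos_itv lo hi k : 0 < lo -> cont_pos k ->
  {within `[lo, hi], continuous k}.
Proof.
move=> lo0 ck; apply: continuous_in_subspaceT => t; rewrite inE/= in_itv/=.
by move=> /andP[lot _]; apply: ck; exact: lt_le_trans lot.
Qed.

Lemma cont_pos_integrable lo hi k : 0 < lo -> cont_pos k ->
  leb.-integrable `[lo, hi] (EFin \o k).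
Proof.
move=> lo0 ck; apply: continuous_compact_integrable; first exact: segment_compact.
exact: cont_pos_itv.
Qed.

Lemma Rintegral_sum lo hi (I : Type) (s : seq I) (k : I -> R -> R) :
  0 < lo -> (forall i, cont_pos (k i)) ->
  \int[leb]_(t in `[lo, hi]) (\sum_(i <- s) k i t) =
  \sum_(i <- s) \int[leb]_(t in `[lo, hi]) k i t.
Proof.
move=> lo0 ck; elim: s => [|i s IH].
  rewrite big_nil; under eq_Rintegral do rewrite big_nil.
  by rewrite Rintegral_cst// mul0r.
rewrite big_cons -IH; under eq_Rintegral do rewrite big_cons.
rewrite RintegralD//; first exact: cont_pos_integrable.
rewrite (_ : _ \o _ = (fun t => \sum_(i <- s) (k i t)%:E)%E); last first.
  by apply/funext => t /=; rewrite sumEFin.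
by apply: integrable_sum => // j _; exact: cont_pos_integrable.
Qed.

Lemma Rintegral_split lo mid hi k : 0 < lo -> lo <= mid <= hi -> cont_pos k ->
  \int[leb]_(t in `[lo, hi]) k t =
  \int[leb]_(t in `[lo, mid]) k t + \int[leb]_(t in `[mid, hi]) k t.
Proof.
move=> lo0 /andP[lm mh] ck.
have ik := cont_pos_integrable hi lo0 ck.
rewrite -(@Rintegral_itv_obnd_cbnd _ mid); last first.
  by apply: (integrableS _ _ _ ik) => //; apply: subset_itvr; rewrite bnd_simp.
by rewrite -(Rintegral_itvB ik) ?bnd_simp// addrC subrK.
Qed.

Lemma Rintegral_norm_le lo hi k b : 0 < lo -> cont_pos k -> cont_pos b ->
  (forall t, lo <= t <= hi -> `|k t| <= b t) ->
  `|\int[leb]_(t in `[lo, hi]) k t| <= \int[leb]_(t in `[lo, hi]) b t.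
Proof.
move=> lo0 ck cb kb.
have ik := cont_pos_integrable hi lo0 ck.
rewrite (le_trans (le_normr_Rintegral _ ik))//; apply: le_Rintegral => //.
- exact: (integrable_norm ik).
- exact: cont_pos_integrable.
Qed.

Lemma inv_sqrt_cont_pos : cont_pos (fun t => (Num.sqrt t)^-1).
Proof.
move=> t t0; apply: (@continuousV R _ Num.sqrt); first by rewrite gt_eqF// sqrtr_gt0.
exact: sqrt_continuous.
Qed.

Lemma cont_posM k b : cont_pos k -> cont_pos b -> cont_pos (fun t => k t * b t).
Proof. by move=> ck cb t t0; apply: continuousM; [exact: ck|exact: cb]. Qed.

Lemma cont_posD k b : cont_pos k -> cont_pos b -> cont_pos (fun t => k t + b t).
Proof. by move=> ck cb t t0; apply: continuousD; [exact: ck|exact: cb]. Qed.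

Lemma cont_pos_cst (c : R) : cont_pos (fun=> c).
Proof. by move=> t t0; exact: cst_continuous. Qed.

Lemma cont_pos_inv : cont_pos (fun t => t^-1).
Proof. by move=> t t0; apply: inv_continuous; rewrite gt_eqF. Qed.

Lemma FTC_pos lo hi (F k : R -> R) : 0 < lo -> lo <= hi -> cont_pos k ->
  (forall t, 0 < t -> is_derive t 1 F (k t)) ->
  \int[leb]_(t in `[lo, hi]) k t = F hi - F lo.
Proof.
move=> lo0; rewrite le_eqVlt => /predU1P[<- _ _|lohi ck dF].
  by rewrite set_itv1 Rintegral_set1 subrr.
have cF t : 0 < t -> {for t, continuous F}.
  move=> t0; apply/differentiable_continuous/derivable1_diffP.
  by have := dF t t0; case.
rewrite /Rintegral (@continuous_FTC2 _ k F)//; first exact: cont_pos_itv.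
- split.
  + move=> t; rewrite in_itv/= => /andP[lot _].
    by have := dF t (lt_trans lo0 lot); case.
  + by apply: cvg_at_right_filter; apply: cF.
  + by apply: cvg_at_left_filter; apply: cF; exact: lt_trans lohi.
- move=> t; rewrite in_itv/= => /andP[lot _].
  by rewrite derive1E; have := dF t (lt_trans lo0 lot); move=> ?; rewrite derive_val.
Qed.

Lemma integral_inv_sqrt lo hi : 0 < lo -> lo <= hi ->
  \int[leb]_(t in `[lo, hi]) (Num.sqrt t)^-1 <= 2 * Num.sqrt hi.
Proof.
move=> lo0 lohi.
have dF t : 0 < t -> is_derive t 1 (fun t => 2 * Num.sqrt t) (Num.sqrt t)^-1.
  move=> t0; have dt := is_derive1_sqrt t0.
  apply: is_derive_eq; rewrite /GRing.scale/=.
  by field; rewrite gt_eqF// sqrtr_gt0.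
rewrite (FTC_pos lo0 lohi inv_sqrt_cont_pos dF).
by rewrite lerBlDr lerDl mulr_ge0// sqrtr_ge0.
Qed.

Lemma integral_inv_sqrt3 lo hi : 0 < lo -> lo <= hi ->
  \int[leb]_(t in `[lo, hi]) (t^-1 * (Num.sqrt t)^-1) <= 2 * (Num.sqrt lo)^-1.
Proof.
move=> lo0 lohi.
have dF t : 0 < t ->
    is_derive t 1 (fun t => - 2 * (Num.sqrt t)^-1) (t^-1 * (Num.sqrt t)^-1).
  move=> t0; have dt := is_derive1_sqrt t0.
  have s0 : Num.sqrt t != 0 by rewrite gt_eqF// sqrtr_gt0.
  have dV := is_deriveV s0.
  apply: is_derive_eq; rewrite /GRing.scale/=.
  rewrite -[X in _ = X^-1 * _](sqr_sqrtr (ltW t0)).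
  by field.
rewrite (FTC_pos lo0 lohi (cont_posM cont_pos_inv inv_sqrt_cont_pos) dF).
by rewrite !mulNr opprK addrC gerBl mulr_ge0// invr_ge0 sqrtr_ge0.
Qed.
End integrals.

Section truncated_operator.
Context (R : realType) (n p : nat).
Local Notation V := 'rV[R]_n.+1.
Local Notation leb := (@lebesgue_measure R).
Variables (a : 'I_p -> V) (mu : 'I_p -> R).
Implicit Types (f g : V -> R) (lo hi t h s : R) (x y u : V).

Definition stencil f x h : R := \sum_(i < p) mu i * f (x + h *: a i).

Definition Omega_itv lo hi f x : R :=
  \int[leb]_(h in `[lo, hi]) (stencil f x h / h / h).

Lemma Omega_itvE eps f x : Omega a mu f eps x = Omega_itv eps 1 f x.
Proof. by []. Qed.

Lemma stencil_cont_pos f x : continuous f -> cont_pos (fun h => stencil f x h / h / h).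
Proof.
move=> cf; suff cs : cont_pos (stencil f x).
  exact: (cont_posM (cont_posM cs (@cont_pos_inv R)) (@cont_pos_inv R)).
have cadd : continuous (fun z : R * R => z.1 + z.2) by exact: add_continuous.
move=> t _; apply: (@continuous_big R _ +%R 0 xpredT cadd R _
  (fun i h => mu i * f (x + h *: a i))) => i _ h.
have cl := @continuous_line R n f x (a i) cf h.
exact: cvgMl_tmp cl.
Qed.

Lemma Omega_itv_translate lo hi f u x :
  Omega_itv lo hi (fun y => f (y + u)) x = Omega_itv lo hi f (x + u).
Proof.
apply: eq_Rintegral => h _; congr (_ / _ / _); apply: eq_bigr => i _.
by rewrite addrAC.
Qed.

Lemma Omega_itvB lo hi f g x : 0 < lo -> continuous f -> continuous g ->
  Omega_itv lo hi (fun y => f y - g y) x = Omega_itv lo hi f x - Omega_itv lo hi g x.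
Proof.
move=> lo0 cf cg; rewrite /Omega_itv -RintegralB//; last 2 first.
- by apply: cont_pos_integrable => //; exact: stencil_cont_pos.
- by apply: cont_pos_integrable => //; exact: stencil_cont_pos.
apply: eq_Rintegral => h _.
rewrite /stencil -!mulrBl; congr (_ / _ / _); rewrite -sumrB.
by apply: eq_bigr => i _; rewrite mulrBr.
Qed.

Lemma Omega_itv_corner_mean lo hi h f x : 0 < lo -> continuous f ->
  Omega_itv lo hi (corner_mean h f) x = corner_mean h (Omega_itv lo hi f) x.
Proof.
move=> lo0 cf; rewrite /corner_mean.
have cS (S : {set 'I_n.+1}) :
  cont_pos (fun t => stencil f (x + h *: corner R S) t / t / t).
  exact: stencil_cont_pos.
rewrite -Rintegral_sum// -RintegralZl//; last first.
  rewrite (_ : _ \o _ = (fun t => \sum_(S : {set 'I_n.+1})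
    (stencil f (x + h *: corner R S) t / t / t)%:E)%E); last first.
    by apply/funext => t /=; rewrite sumEFin.
  by apply: integrable_sum => // S _; exact: cont_pos_integrable.
apply: eq_Rintegral => t _.
rewrite -!mulr_suml !mulrA; congr (_ / _ / _).
rewrite /stencil; under [LHS]eq_bigr do rewrite mulrCA mulr_sumr.
rewrite -mulr_sumr exchange_big/=; congr (_ * _); apply: eq_bigr => S _.
by apply: eq_bigr => i _; rewrite addrAC.
Qed.

(** The operator is linear and commutes with translations. *)
Lemma Omega_itv_grid_mean lo hi r s f x : 0 < lo -> continuous f ->
  Omega_itv lo hi (grid_mean r s f) x = grid_mean r s (Omega_itv lo hi f) x.
Proof.
move=> lo0 cf; elim: r s x => [|r IH] s x //=.
rewrite Omega_itv_corner_mean//; last exact: continuous_grid_mean.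
by congr (_ * _); apply: eq_bigr => S _; rewrite IH.
Qed.

Lemma Omega_itv_split lo mid hi f x : 0 < lo -> lo <= mid <= hi -> continuous f ->
  Omega_itv lo hi f x = Omega_itv lo mid f x + Omega_itv mid hi f x.
Proof. by move=> lo0 lmh cf; apply: Rintegral_split => //; exact: stencil_cont_pos. Qed.

Lemma Omega_itv_le lo hi f x (b : R -> R) : 0 < lo -> continuous f -> cont_pos b ->
  (forall h, lo <= h <= hi -> `|stencil f x h| <= b h * h ^+ 2) ->
  `|Omega_itv lo hi f x| <= \int[leb]_(h in `[lo, hi]) b h.
Proof.
move=> lo0 cf cb fb; apply: Rintegral_norm_le => //; first exact: stencil_cont_pos.
move=> h /andP[loh hhi]; have h0 : 0 < h by apply: lt_le_trans loh.
rewrite -mulrA -invfM normrM normfV (gtr0_norm (mulr_gt0 h0 h0)).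
by rewrite ler_pdivrMr ?mulr_gt0// -expr2 fb// loh.
Qed.

End truncated_operator.

(** * Size, regularity and cancellation of the operator *)

Ltac nneg := first
  [ by [] | solve [apply: ltW; assumption] | exact: sqrtr_ge0
  | apply: mulr_ge0; nneg | apply: divr_ge0; nneg | apply: addr_ge0; nneg
  | rewrite invr_ge0; nneg | apply: exprn_ge0; nneg ].

Definition stencil_radius (R : realType) (n p : nat) (a : 'I_p -> 'rV[R]_n.+1) : R :=
  n.+1%:R * (1 + \sum_(i < p) `|a i|).

Definition stencil_mass (R : realType) (p : nat) (mu : 'I_p -> R) : R :=
  \sum_(i < p) `|mu i|.

Definition stencil_const (R : realType) (n p : nat) (mu : 'I_p -> R) : R :=
  4 * n.+1%:R * stencil_mass mu.

Section stencil_constants.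
Context (R : realType) (n p : nat).
Variables (a : 'I_p -> 'rV[R]_n.+1) (mu : 'I_p -> R).

Lemma stencil_radius_ge1 : 1 <= stencil_radius a.
Proof. by rewrite -[leLHS]mulr1 ler_pM ?ler1n// lerDl sumr_ge0. Qed.

Lemma norm_le_stencil_radius i : `|a i| <= stencil_radius a.
Proof.
rewrite -[leLHS]mul1r ler_pM ?ler1n// (bigD1 i)//= addrCA lerDl.
by rewrite addr_ge0// sumr_ge0.
Qed.

Lemma stencil_mass_ge0 : 0 <= stencil_mass mu.
Proof. exact: sumr_ge0. Qed.

Lemma stencil_const_ge0 : 0 <= stencil_const n mu.
Proof. by rewrite /stencil_const !mulr_ge0// stencil_mass_ge0. Qed.

End stencil_constants.

Section operator_estimates.
Context (R : realType) (n p : nat).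
Local Notation V := 'rV[R]_n.+1.
Local Notation leb := (@lebesgue_measure R).
Variables (a : 'I_p -> V) (mu : 'I_p -> R).
Hypotheses (mu0 : \sum_(i < p) mu i = 0) (mua0 : \sum_(i < p) mu i *: a i = 0).
Variable M : R.
Hypothesis M0 : 0 <= M.
Implicit Types (f g : V -> R) (lo hi t h s : R) (x y u v : V).

Local Notation c := (stencil_radius a).
Local Notation m := (stencil_mass mu).
Local Notation B := (stencil_const n mu).

Let c1 : 1 <= c. Proof. exact: stencil_radius_ge1. Qed.
Let c0 : 0 < c. Proof. exact: lt_le_trans c1. Qed.
Let m0 : 0 <= m. Proof. exact: stencil_mass_ge0. Qed.
Let B0 : 0 <= B. Proof. exact: stencil_const_ge0. Qed.

Lemma stencil_le f x h eta : 0 < h -> continuous f ->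
  (forall v y, `|v| <= c * h -> `|diff2 f v y| <= eta) ->
  `|stencil a mu f x h| <= B * eta.
Proof.
move=> h0 cf feta.
pose G z := f (x + h *: z).
apply: (@balanced_sum_le R n p a mu G) => //.
- move=> z; apply: continuous_comp; last exact: cf.
  have cz : h *: y @[y --> z] --> h *: z.
    exact: (@scaler_continuous R V h z).
  exact: (@cvgD R V V (nbhs z) (nbhs_filter z) (cst x) _ _ _ (cvg_cst x) cz).
- move=> v y vc; rewrite (_ : diff2 G v y = diff2 f (h *: v) (x + h *: y)).
    by apply: feta; rewrite normrZ gtr0_norm// mulrC ler_pM2r.
  by rewrite /diff2 /G scalerDr scalerBr !addrA.
Qed.

Lemma stencil_zygmund f x h : 0 < h -> continuous f -> zygmund_le f M ->
  `|stencil a mu f x h| <= B * (M * (c * h)).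
Proof.
move=> h0 cf fM; apply: stencil_le => // v y vc.
by rewrite (le_trans (fM _ _))// ler_wpM2l.
Qed.

(** As the mu i sum to 0, f x - f y can be subtracted from every term, which
    turns it into a mixed difference. *)
Lemma stencil_increment f x y h : 0 < h -> zygmund_le f M ->
  `|stencil a mu f x h - stencil a mu f y h| <=
    m * (4 * M * Num.sqrt (c * `|x - y| * h)).
Proof.
move=> h0 fM; rewrite /stencil -sumrB.
have -> : \sum_(i < p) (mu i * f (x + h *: a i) - mu i * f (y + h *: a i)) =
    \sum_(i < p) mu i * cross f (h *: a i) (x - y) y.
  have yx : y + (x - y) = x by rewrite addrC subrK.
  transitivity (\sum_(i < p) (mu i * cross f (h *: a i) (x - y) y +
      mu i * (f x - f y))).
    apply: eq_bigr => i _; rewrite /cross (addrAC y (h *: _)) yx; ring.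
  by rewrite big_split/= -mulr_suml mu0 mul0r addr0.
rewrite /stencil_mass mulr_suml (le_trans (ler_norm_sum _ _ _))//; apply: ler_sum => i _.
rewrite normrM ler_wpM2l// (le_trans (cross_zygmund _ _ _ _ fM))//.
rewrite ler_wpM2l ?mulr_ge0// ler_wsqrtr// normrZ gtr0_norm//.
have -> : c * `|x - y| * h = h * c * `|x - y| by ring.
by rewrite ler_wpM2r// ler_wpM2l ?(ltW h0)// norm_le_stencil_radius.
Qed.

(** For c * h > s the average brings no gain, but then the Zygmund bound for f is
    already below the right-hand side. *)
Lemma stencil_grid_mean f x h r s : 0 < h -> 0 < s -> continuous f ->
  zygmund_le f M ->
  `|stencil a mu (grid_mean r s f) x h| <= B * (4 * n.+1%:R * M *
     (c * h / s * Num.sqrt (c * h * s) + Num.sqrt (c * h * (s / 2 ^+ r)))).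
Proof.
move=> h0 s0 cf fM; apply: stencil_le => //; first exact: continuous_grid_mean.
move=> v y vc.
have n4 : 1 <= 4 * n.+1%:R :> R by rewrite -natrM ler1n.
have ch0 : 0 < c * h by rewrite mulr_gt0.
have [vs|sv] := leP `|v| s.
  rewrite (le_trans (grid_mean_diff2 r y M0 fM s0 vs))//.
  rewrite ler_wpM2l ?mulr_ge0//.
  apply: lerD; last by rewrite ler_wsqrtr// ler_wpM2r// divr_ge0 ?exprn_ge0// ltW.
  apply: ler_pM; rewrite ?sqrtr_ge0 ?divr_ge0 ?(ltW s0)//.
  - by rewrite ler_wpM2r// invr_ge0 ltW.
  - by rewrite ler_wsqrtr// ler_wpM2r// ltW.
have sch : s < c * h by apply: lt_le_trans vc.
rewrite (le_trans (zygmund_grid_mean r s fM _ _))//.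
apply: (@le_trans _ _ (M * (c * h / s * Num.sqrt (c * h * s)))).
  rewrite ler_wpM2l// (le_trans vc)// -mulrA ler_peMr ?(ltW ch0)//.
  rewrite mulrC ler_pdivlMr// mul1r -[leLHS]gtr0_norm// -sqrtr_sqr ler_wsqrtr//.
  by rewrite expr2 ler_wpM2r ?ltW.
set X := c * h / s * _.
have X0 : 0 <= X by rewrite mulr_ge0 ?sqrtr_ge0// divr_ge0 ?ltW.
have Y0 := sqrtr_ge0 (c * h * (s / 2 ^+ r)).
rewrite -(mulrA (4 * _)); apply: (@le_trans _ _ (M * (X + Num.sqrt
    (c * h * (s / 2 ^+ r))))); first by rewrite ler_wpM2l// lerDl.
by rewrite ler_peMl// mulr_ge0// addr_ge0.
Qed.

Lemma Omega_itv_short f lo hi x : 0 < lo -> lo <= hi <= 2 * lo ->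
  continuous f -> zygmund_le f M -> `|Omega_itv a mu lo hi f x| <= B * (M * c).
Proof.
move=> lo0 /andP[lohi hi2] cf fM.
have := @Omega_itv_le R n p a mu lo hi f x (fun=> B * (M * c) / lo) lo0 cf
  (@cont_pos_cst R _).
rewrite Rintegral_cst//= lebesgue_measure_itv/= lte_fin.
move=> H; apply: (le_trans (H _)).
  move=> h /andP[loh _]; have h0 : 0 < h by apply: lt_le_trans loh.
  rewrite (le_trans (stencil_zygmund _ h0 cf fM))//.
  have -> : B * (M * c) / lo * h ^+ 2 = B * (M * (c * h)) * (h / lo) by ring.
  apply: ler_peMr; last by rewrite ler_pdivlMr// mul1r.
  nneg.
case: ifPn => _ /=; last by rewrite mulr0; nneg.
rewrite -mulrA ler_piMr//; first nneg.
by rewrite mulrC ler_pdivrMr// mul1r; lra.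
Qed.

(** The integral of sqrt (lo * h) / h ^ 2 over h >= lo is bounded
    independently of lo. *)
Lemma Omega_itv_increment f lo hi x y : 0 < lo -> lo <= hi -> `|x - y| <= lo ->
  continuous f -> zygmund_le f M ->
  `|Omega_itv a mu lo hi f x - Omega_itv a mu lo hi f y| <=
    8 * m * M * Num.sqrt c.
Proof.
move=> lo0 lohi xy cf fM.
pose fx (z : V) := f (z + x); pose fy (z : V) := f (z + y).
have cfx u : continuous (fun z : V => f (z + u)) by exact: continuous_translate.
have <- : Omega_itv a mu lo hi (fun z => fx z - fy z) 0 =
  Omega_itv a mu lo hi f x - Omega_itv a mu lo hi f y.
  have e u : Omega_itv a mu lo hi (fun z => f (z + u)) 0 = Omega_itv a mu lo hi f u.
    by rewrite Omega_itv_translate add0r.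
  by rewrite -!e -Omega_itvB//; exact: cfx.
pose K := 4 * m * M * Num.sqrt c * Num.sqrt lo.
have cb : cont_pos (fun t => K * (t^-1 * (Num.sqrt t)^-1)).
  apply: cont_posM; first exact: cont_pos_cst.
  by apply: cont_posM; [exact: cont_pos_inv|exact: inv_sqrt_cont_pos].
have K0 : 0 <= K by rewrite /K; nneg.
apply: le_trans (Omega_itv_le lo0 _ cb _) _.
- by move=> z; exact: cvgB (cfx x z) (cfx y z).
- move=> h /andP[loh _]; have h0 : 0 < h by apply: lt_le_trans loh.
  have -> : stencil a mu (fun z => fx z - fy z) 0 h =
      stencil a mu f x h - stencil a mu f y h.
    rewrite /stencil -sumrB; apply: eq_bigr => i _.
    by rewrite /fx /fy add0r !(addrC (h *: _)) mulrBr.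
  rewrite (le_trans (stencil_increment _ _ h0 fM))//.
  have -> : K * (h^-1 * (Num.sqrt h)^-1) * h ^+ 2 =
     m * (4 * M * (Num.sqrt c * Num.sqrt lo * Num.sqrt h)).
    rewrite /K -{1 3}(sqr_sqrtr (ltW h0)); field.
    by rewrite gt_eqF// sqrtr_gt0.
  rewrite ler_wpM2l// ler_wpM2l ?mulr_ge0//.
  rewrite -(@sqrtrM _ c) ?(ltW c0)// -(@sqrtrM _ (c * lo)); last nneg.
  by rewrite ler_wsqrtr// ler_wpM2r ?(ltW h0)// ler_pM2l.
rewrite RintegralZl//; last first.
  apply: cont_pos_integrable => //.
  by apply: cont_posM; [exact: cont_pos_inv|exact: inv_sqrt_cont_pos].
apply: (@le_trans _ _ (K * (2 * (Num.sqrt lo)^-1))).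
  by rewrite ler_wpM2l// integral_inv_sqrt3.
rewrite le_eqVlt; apply/orP; left; apply/eqP.
by rewrite /K; field; rewrite gt_eqF// sqrtr_gt0.
Qed.

(** The gain sqrt (h / s) makes the integral over h <= s bounded by its largest
    scales; the error due to the spacing lo of the grid, of order
    sqrt (lo * h) / h ^ 2, is dominated by its smallest ones. *)
Lemma grid_mean_Omega_itv f r s x : 0 < s -> continuous f -> zygmund_le f M ->
  `|grid_mean r s (Omega_itv a mu (s / 2 ^+ r) s f) x| <=
    16 * B * n.+1%:R * M * (c * Num.sqrt c).
Proof.
move=> s0 cf fM.
pose lo := s / 2 ^+ r; rewrite -/lo.
have lo0 : 0 < lo by rewrite divr_gt0// exprn_gt0.
have los : lo <= s.
  by rewrite ler_pdivrMr ?exprn_gt0// ler_peMr ?(ltW s0)// exprn_ege1// ler1n.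
have cs0 : Num.sqrt c != 0 by rewrite gt_eqF// sqrtr_gt0.
have ss0 : Num.sqrt s != 0 by rewrite gt_eqF// sqrtr_gt0.
have sl0 : Num.sqrt lo != 0 by rewrite gt_eqF// sqrtr_gt0.
rewrite -Omega_itv_grid_mean//.
pose K := 4 * B * n.+1%:R * M * (c * Num.sqrt c).
have K0 : 0 <= K by rewrite /K; nneg.
pose b1 t : R := (Num.sqrt t)^-1.
pose b2 t : R := t^-1 * (Num.sqrt t)^-1.
have cb1 : cont_pos b1 by exact: inv_sqrt_cont_pos.
have cb2 : cont_pos b2.
  by apply: cont_posM; [exact: cont_pos_inv|exact: inv_sqrt_cont_pos].
pose b t := K / Num.sqrt s * b1 t + K * Num.sqrt lo * b2 t.
have cKb (k : R) b' : cont_pos b' -> cont_pos (fun t => k * b' t).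
  by apply: cont_posM; exact: cont_pos_cst.
have cb : cont_pos b by apply: cont_posD; exact: cKb.
apply: le_trans (Omega_itv_le lo0 _ cb _) _.
- exact: continuous_grid_mean.
- move=> h /andP[loh _]; have h0 : 0 < h by apply: lt_le_trans loh.
  have sh0 : Num.sqrt h != 0 by rewrite gt_eqF// sqrtr_gt0.
  rewrite (le_trans (stencil_grid_mean _ _ h0 s0 cf fM))// -/lo.
  have ch0 : 0 <= c * h by nneg.
  rewrite (@sqrtrM _ _ s ch0) (@sqrtrM _ _ lo ch0) (@sqrtrM _ _ h (ltW c0)).
  have -> : b h * h ^+ 2 = B * (4 * n.+1%:R * M * (
     (c * h / s * (Num.sqrt c * Num.sqrt h * Num.sqrt s)) +
     c * (Num.sqrt c * Num.sqrt h * Num.sqrt lo))).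
    have hE := sqr_sqrtr (ltW h0); have sE := sqr_sqrtr (ltW s0).
    rewrite /b /b1 /b2 /K.
    set u := Num.sqrt h in hE sh0 *; set q := Num.sqrt s in sE ss0 *.
    rewrite -hE -sE; field.
    by rewrite sh0 ss0.
  apply: ler_wpM2l => //; apply: ler_wpM2l; first nneg.
  by rewrite lerD2l ler_peMl//; nneg.
rewrite RintegralD//; [|exact: cont_pos_integrable (cKb _ _ _)..].
rewrite !RintegralZl//; [|exact: cont_pos_integrable..].
have h1 : K / Num.sqrt s * \int[leb]_(t in `[lo, s]) b1 t <= 2 * K.
  apply: (@le_trans _ _ (K / Num.sqrt s * (2 * Num.sqrt s))).
    by rewrite ler_wpM2l ?divr_ge0 ?sqrtr_ge0// integral_inv_sqrt.
  by rewrite le_eqVlt; apply/orP; left; apply/eqP; field.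
have h2 : K * Num.sqrt lo * \int[leb]_(t in `[lo, s]) b2 t <= 2 * K.
  apply: (@le_trans _ _ (K * Num.sqrt lo * (2 * (Num.sqrt lo)^-1))).
    by apply: ler_wpM2l; [nneg|exact: integral_inv_sqrt3].
  by rewrite le_eqVlt; apply/orP; left; apply/eqP; field.
by apply: le_trans (lerD h1 h2) _; rewrite /K; lra.
Qed.

End operator_estimates.

(** * The maximal inequality on the dyadic tree *)

Section maximal_inequality.
Context (R : realType) (n : nat).
Local Notation V := 'rV[R]_n.+1.
Implicit Types (x y : V) (s t : R) (T : {set 'I_n.+1}).

(** Half-open, so that the children of a cube partition it. *)
Definition cube x s : set V := [set y | forall i, x ord0 i <= y ord0 i < x ord0 i + s].

(** The factor 2 leaves room for an open box around the half-open cube. *)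
Lemma lebesgue_outer_cube x s : 0 < s ->
  (lebesgue_outer (cube x s) <= ((2 * s) ^+ n.+1)%:E)%E.
Proof.
move=> s0; apply: ereal_inf_lbound => /=.
pose Q : V * V := (\row_j (x ord0 j - s), \row_j (x ord0 j + s)).
exists (fun k => if k == 0%N then Q else (0, 0)).
  move=> y xy; exists 0%N => // i; have /andP[h1 h2] := xy i.
  by rewrite !mxE h2 andbT; lra.
rewrite (nneseries_split 0 1); last first.
  by move=> k _; rewrite lee_fin prodr_ge0// => i _; rewrite le_max lexx.
rewrite big_nat1 eseries0 ?adde0; last first.
  move=> k k0 _; rewrite gtn_eqF//.
  by congr EFin; rewrite /box_volume big_ord_recl /= !mxE subrr maxxx mul0r.
rewrite /= /box_volume; congr EFin.
rewrite (eq_bigr (fun=> 2 * s)) ?prodr_const ?card_ord// => i _.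
rewrite !mxE max_r; first by ring.
by lra.
Qed.

Lemma cube_split x s y : cube x s y ->
  exists T, cube (x + (s / 2) *: corner R T) (s / 2) y.
Proof.
move=> xy; exists [set i | x ord0 i + s / 2 <= y ord0 i]%SET => i.
have /andP[h1 h2] := xy i; rewrite !mxE inE.
have [h|h] := leP (x ord0 i + s / 2) (y ord0 i) => /=.
  by rewrite mulr1 h/=; lra.
by rewrite mulr0 addr0 h1.
Qed.

Lemma cube_norm x s y : cube x s y -> `|y - x| <= s.
Proof.
move=> xy; apply: norm_le_coord => [|i].
  by have /andP[h1 h2] := xy ord0; lra.
have /andP[h1 h2] := xy i.
by rewrite !mxE ler_norml; apply/andP; split; lra.
Qed.

Lemma lebesgue_outer_fin_bigcup (I : finType) (F : I -> set V) :
  (lebesgue_outer [set y | exists i, F i y] <= \sum_i lebesgue_outer (F i))%E.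
Proof.
have H (l : seq I) : (lebesgue_outer [set y | exists2 i, i \in l & F i y] <=
    \sum_(i <- l) lebesgue_outer (F i))%E.
  elim: l => [|i l IH].
    rewrite big_nil (_ : [set _ | _] = set0) ?lebesgue_outer0//.
    by rewrite -subset0 => y [].
  rewrite big_cons; apply: le_trans (leeD (lexx _) IH).
  apply: le_trans (outer_measureU2 _ _ _).
  apply: le_lebesgue_outer => y [j]; rewrite inE => /orP[/eqP ->|jl] Fy; first by left.
  by right; exists j.
apply: le_trans (H (index_enum I)).
by apply: le_lebesgue_outer => y [i Fy]; exists i; rewrite ?mem_index_enum.
Qed.

(** From exp u <= 1 / (1 - u). *)
Lemma expR_le_quadratic (u : R) : u <= 1 / 2 -> expR u <= 1 + u + 2 * u ^+ 2.
Proof.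
move=> u2; have h : 0 < 1 - u by lra.
rewrite -[leLHS]invrK -expRN (@le_trans _ _ (1 - u)^-1)//.
  by rewrite lef_pV2 ?posrE ?expR_gt0// expR_ge1Dx.
rewrite -[leLHS]mul1r ler_pdivrMr//.
have u20 : 0 <= u ^+ 2 by rewrite sqr_ge0.
have : 0 <= u ^+ 2 * (1 - 2 * u) by rewrite mulr_ge0//; lra.
have -> : (1 + u + 2 * u ^+ 2) * (1 - u) = 1 + u ^+ 2 * (1 - 2 * u) by ring.
lra.
Qed.

(** The linear term of the expansion of the exponential averages to 0. *)
Lemma corner_mean_expR h (X : V -> R) x (c t B : R) : 0 <= t -> t * B <= 1 / 2 ->
  corner_mean h X x = c -> (forall T, `|X (x + h *: corner R T) - c| <= B) ->
  corner_mean h (fun y => expR (t * X y)) x <= expR (t * c + 2 * t ^+ 2 * B ^+ 2).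
Proof.
move=> t0 tB Xc XB.
have step T : expR (t * X (x + h *: corner R T)) <= expR (t * c) *
    (1 + t * (X (x + h *: corner R T) - c) + 2 * t ^+ 2 * B ^+ 2).
  set y := _ + _.
  rewrite (_ : t * X y = t * c + t * (X y - c)); last by ring.
  rewrite expRD ler_wpM2l ?expR_ge0//.
  have hB := XB T; rewrite -/y in hB.
  have u2 : t * (X y - c) <= 1 / 2.
    by rewrite (le_trans _ tB)// ler_wpM2l// (le_trans (ler_norm _)).
  rewrite (le_trans (expR_le_quadratic u2))// lerD2l exprMn mulrA ler_wpM2l//.
    by rewrite mulr_ge0// sqr_ge0.
  by rewrite -(@real_normK _ (X y - c)) ?num_real// ler_sqr ?nnegrE// (le_trans _ hB).
rewrite expRD /corner_mean.
apply: (@le_trans _ _ ((2 ^+ n.+1)^-1 * \sum_T expR (t * c) *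
    (1 + t * (X (x + h *: corner R T) - c) + 2 * t ^+ 2 * B ^+ 2))).
  rewrite ler_wpM2l ?invr_ge0 ?exprn_ge0//; apply: ler_sum => T _; exact: step.
rewrite -mulr_sumr mulrCA ler_wpM2l ?expR_ge0// !big_split/= !mulrDr !mean_cst.
rewrite -mulr_sumr sumrB (mulrCA _ t) mulrBr mean_cst -/(corner_mean h X x) Xc.
by rewrite subrr mulr0 addr0 expR_ge1Dx.
Qed.

(** If X k x > lam, the right-hand side exceeds the measure of the cube.
    Otherwise S k <= lam + C on the cube, so the exceptional set is contained
    in the union of those of the children, and [corner_mean_expR] turns the sum
    of their bounds into the bound for the parent. *)
Lemma maximal_tree (S X : nat -> V -> R) (N : nat) (lam t B C : R) :
  0 <= t -> t * B <= 1 / 2 ->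
  (forall k x, (k < N)%N -> X k x = corner_mean (2 ^- k / 2) (X k.+1) x) ->
  (forall k x T, (k < N)%N ->
     `|X k.+1 (x + (2 ^- k / 2) *: corner R T) - X k x| <= B) ->
  (forall k x y, (k <= N)%N -> cube x (2 ^- k) y -> S k y <= X k x + C) ->
  forall r k x, (k + r)%N = N ->
  (lebesgue_outer [set y | cube x (2 ^- k) y /\
     exists m, (k <= m <= N)%N /\ (lam + C < S m y)%R] <=
   ((2 * 2 ^- k) ^+ n.+1 *
     expR (t * (X k x - lam) + 2 * t ^+ 2 * B ^+ 2 * r%:R))%:E)%E.
Proof.
move=> t0 tB mart incr near; elim => [|r IH] k x krN.
all: have s0 : 0 < 2 ^- k :> R by rewrite invr_gt0 exprn_gt0.
all: have kN : (k <= N)%N by rewrite -krN leq_addr.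
all: have [lX|Xl] := ltP lam (X k x).
1,3: apply: (@le_trans _ _ (lebesgue_outer (cube x (2 ^- k)))); first by
  apply: le_lebesgue_outer => y [].
1,2: apply: (le_trans (lebesgue_outer_cube x s0)).
1,2: rewrite lee_fin ler_peMr ?exprn_ge0 ?mulr_ge0 ?(ltW s0)// -[leLHS]expR0 ler_expR.
1,2: apply: addr_ge0; first by rewrite mulr_ge0// subr_ge0 ltW.
1,2: by rewrite mulr_ge0// mulr_ge0 ?sqr_ge0// mulr_ge0 ?sqr_ge0.
- rewrite (_ : [set _ | _] = set0).
    by rewrite lebesgue_outer0 lee_fin mulr_ge0 ?expR_ge0 ?exprn_ge0 ?mulr_ge0 ?(ltW s0).
  rewrite -subset0 => y [xy [m [/andP[km mN] lm]]].
  have mk : m = k by lia.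
  by have := near _ _ _ kN xy; rewrite mk in lm; lra.
have kN' : (k < N)%N by lia.
have k1E : 2 ^- k.+1 = 2 ^- k / 2 :> R by rewrite exprS invfM mulrC.
pose F T := [set y | cube (x + (2 ^- k / 2) *: corner R T) (2 ^- k.+1) y /\
     exists m, (k.+1 <= m <= N)%N /\ lam + C < S m y].
apply: (@le_trans _ _ (\sum_(T : {set 'I_n.+1}) lebesgue_outer (F T))%E).
  apply: le_trans (lebesgue_outer_fin_bigcup F).
  apply: le_lebesgue_outer => y [xy [m [/andP[km mN] lm]]].
  have [T xyT] := cube_split xy; exists T; split; first by rewrite k1E.
  exists m; split => //; rewrite mN andbT ltn_neqAle km andbT.
  by apply/eqP => mk; have := near _ _ _ kN xy; rewrite -mk in lm; lra.
have kr : (k.+1 + r)%N = N by rewrite addSnnS.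
apply: (@le_trans _ _ (\sum_(T : {set 'I_n.+1}) ((2 * 2 ^- k.+1) ^+ n.+1 *
    expR (t * (X k.+1 (x + (2 ^- k / 2) *: corner R T) - lam) +
      2 * t ^+ 2 * B ^+ 2 * r%:R))%:E)%E).
  by apply: lee_sum => T _; exact: IH.
rewrite sumEFin lee_fin -mulr_sumr.
have -> : (2 * 2 ^- k.+1) ^+ n.+1 = (2 * 2 ^- k) ^+ n.+1 * (2 ^+ n.+1)^-1 :> R.
  by rewrite k1E mulrA exprMn exprVn.
rewrite -(mulrA ((2 * 2 ^- k) ^+ n.+1)).
apply: ler_wpM2l; first by rewrite exprn_ge0// mulr_ge0// ltW.
have := corner_mean_expR t0 tB (esym (mart k x kN')) (fun T => incr k x T kN').
rewrite /corner_mean => h.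
have -> : \sum_(T : {set 'I_n.+1}) expR (t * (X k.+1 (x + (2 ^- k / 2) *: corner R T)
      - lam) + 2 * t ^+ 2 * B ^+ 2 * r%:R) =
   (\sum_(T : {set 'I_n.+1}) expR (t * X k.+1 (x + (2 ^- k / 2) *: corner R T))) *
     expR (- (t * lam) + 2 * t ^+ 2 * B ^+ 2 * r%:R).
  rewrite mulr_suml; apply: eq_bigr => T _; rewrite -expRD; congr expR; ring.
rewrite mulrA (le_trans (ler_wpM2r (expR_ge0 _) h))//.
rewrite -expRD ler_expR -natr1 le_eqVlt; apply/orP; left; apply/eqP; ring.
Qed.

End maximal_inequality.

(** * The martingale attached to the operator *)

Section zygmund_norm.
Context (R : realType) (n : nat).
Local Notation V := 'rV[R]_n.+1.

Lemma norm_le_enorm (v : V) : `|v| <= enorm v.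
Proof.
apply: norm_le_coord => [|i]; first exact: sqrtr_ge0.
rewrite -sqrtr_sqr ler_wsqrtr// (bigD1 i)//= lerDl sumr_ge0// => j _.
exact: sqr_ge0.
Qed.

Lemma enorm_le (v : V) : enorm v <= Num.sqrt n.+1%:R * `|v|.
Proof.
rewrite -[`|v|]ger0_norm// -sqrtr_sqr -sqrtrM// ler_wsqrtr//.
rewrite (@le_trans _ _ (\sum_(i < n.+1) `|v| ^+ 2))//.
  apply: ler_sum => i _; rewrite -[leLHS]real_normK ?num_real//.
  by rewrite ler_sqr ?nnegrE// coord_le_norm.
by rewrite sumr_const card_ord mulr_natl.
Qed.

Lemma zygmund_norm_le (f : V -> R) (M : R) : zygmund_norm f = M%:E ->
  zygmund_le f (`|M| * Num.sqrt n.+1%:R).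
Proof.
move=> fM x v; have [->|v0] := eqVneq v 0.
  rewrite /diff2 addr0 subr0 [X in `|X|](_ : _ = 0) ?normr0 ?mulr0//; ring.
have e0 : 0 < enorm v by rewrite (lt_le_trans _ (norm_le_enorm v))// normr_gt0.
have : ((`|diff2 f v x| / enorm v)%:E <= M%:E)%E.
  by rewrite -fM; apply: ereal_sup_ubound; exists x => //; exists v.
rewrite lee_fin ler_pdivrMr// => /le_trans; apply.
apply: (@le_trans _ _ (`|M| * enorm v)).
  by rewrite ler_wpM2r ?(ltW e0)// ler_norm.
by rewrite -mulrA ler_wpM2l// enorm_le.
Qed.

End zygmund_norm.

Section law_of_iterated_logarithm.
Context (R : realType) (n p : nat).
Local Notation V := 'rV[R]_n.+1.
Variables (a : 'I_p -> V) (mu : 'I_p -> R).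
Hypotheses (mu0 : \sum_(i < p) mu i = 0) (mua0 : \sum_(i < p) mu i *: a i = 0).
Implicit Types (f : V -> R) (x y : V).

Definition dyadic_Omega f m : V -> R := Omega_itv a mu (2 ^- m) 1 f.

Definition Omega_martingale f N k : V -> R :=
  grid_mean (N - k) (2 ^- k) (dyadic_Omega f N).

Lemma exp2V_gt0 m : 0 < 2 ^- m :> R.
Proof. by rewrite invr_gt0 exprn_gt0. Qed.

Lemma exp2V_le k N : (k <= N)%N -> 2 ^- N <= 2 ^- k :> R.
Proof. by move=> kN; rewrite lef_pV2 ?posrE ?exprn_gt0// ler_eXn2l// ltr1n. Qed.

Lemma exp2V_le1 m : 2 ^- m <= 1 :> R.
Proof. by rewrite invf_le1 ?exprn_gt0// exprn_ege1// ler1n. Qed.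

(** The average of S_N over a cube of generation k splits into that of the scales
    finer than the cube, where cancellation applies, and that of S_k, which is
    nearly constant on the cube. *)
Lemma Omega_martingale_approx (M : R) : 0 <= M -> exists2 K : R, 0 < K &
  forall f, continuous f -> zygmund_le f M ->
  (forall lo hi x, 0 < lo -> lo <= hi <= 2 * lo -> `|Omega_itv a mu lo hi f x| <= K) /\
  (forall N k x y, (k <= N)%N -> `|y - x| <= 2 ^- k ->
     `|Omega_martingale f N k x - dyadic_Omega f k y| <= K).
Proof.
move=> M0.
set c := stencil_radius a; set B := stencil_const n mu; set m := stencil_mass mu.
have B0 : 0 <= B by exact: stencil_const_ge0.
have m0 : 0 <= m by exact: stencil_mass_ge0.
have c0 : 0 <= c by apply: le_trans (stencil_radius_ge1 a).
pose K1 := B * (M * c); pose K2 := 8 * m * M * Num.sqrt c.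
pose K3 := 16 * B * n.+1%:R * M * (c * Num.sqrt c).
have K10 : 0 <= K1 by rewrite /K1; nneg.
have K20 : 0 <= K2 by rewrite /K2; nneg.
have K30 : 0 <= K3 by rewrite /K3; nneg.
exists (1 + K1 + K3 + 2 * K2); first by lra.
move=> f cf fM; split=> [lo hi x lo0 lohi|N k x y kN yx].
  by apply: (le_trans (Omega_itv_short mu0 mua0 M0 x lo0 lohi cf fM)); rewrite -/K1; lra.
have k1 := exp2V_le1 k.
have incr u v : `|u - v| <= 2 ^- k ->
    `|dyadic_Omega f k u - dyadic_Omega f k v| <= K2.
  by move=> uv; apply: Omega_itv_increment => //; exact: exp2V_gt0.
have NE : 2 ^- N = 2 ^- k / 2 ^+ (N - k) :> R.
  by rewrite -invfM -exprD subnKC.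
have tail : `|Omega_martingale f N k x -
    grid_mean (N - k) (2 ^- k) (dyadic_Omega f k) x| <= K3.
  rewrite -grid_meanB.
  rewrite (@eq_grid_mean _ _ _ _ _ (Omega_itv a mu (2 ^- k / 2 ^+ (N - k)) (2 ^- k) f)).
    by apply: grid_mean_Omega_itv => //; exact: exp2V_gt0.
  move=> z; rewrite -NE /dyadic_Omega (@Omega_itv_split _ _ _ _ _ (2 ^- N) (2 ^- k))
    ?exp2V_gt0 ?exp2V_le//.
  by rewrite addrK.
have loc : `|grid_mean (N - k) (2 ^- k) (dyadic_Omega f k) x - dyadic_Omega f k x| <= K2.
  by apply: grid_mean_dist => [|z zx]; [exact: ltW (exp2V_gt0 k)|exact: incr].
have xy : `|dyadic_Omega f k x - dyadic_Omega f k y| <= K2.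
  by apply: incr; rewrite distrC.
move: tail loc xy.
set X := Omega_martingale _ _ _ _; set Y := grid_mean _ _ _ _.
set Z := dyadic_Omega _ _ x; set W := dyadic_Omega _ _ y => h1 h2 h3.
rewrite (_ : X - W = (X - Y) + ((Y - Z) + (Z - W))); last by ring.
have h4 := ler_normD (X - Y) ((Y - Z) + (Z - W)).
have h5 := ler_normD (Y - Z) (Z - W).
lra.
Qed.

Definition large_Omega f x N lam : set V :=
  [set y | cube x 1 y /\ exists2 m, (m <= N)%N & lam < `|dyadic_Omega f m y|].

(** The maximal inequality for both signs. Consecutive terms of the martingale
    are compared through S_k and S_(k+1), hence the increments 3 * K. *)
Lemma dyadic_Omega_tail f (K : R) N x (lam t : R) : 0 < K -> continuous f ->
  (forall lo hi x, 0 < lo -> lo <= hi <= 2 * lo -> `|Omega_itv a mu lo hi f x| <= K) ->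
  (forall N k x y, (k <= N)%N -> `|y - x| <= 2 ^- k ->
     `|Omega_martingale f N k x - dyadic_Omega f k y| <= K) ->
  0 <= t -> t * (3 * K) <= 1 / 2 ->
  (lebesgue_outer (large_Omega f x N (lam + K)%R) <=
    (2 * 2 ^+ n.+1 *
       expR (t * (K - lam) + 2 * t ^+ 2 * (3 * K) ^+ 2 * N%:R))%:E)%E.
Proof.
move=> K0 cf short approx t0 tK.
pose X k y := Omega_martingale f N k y; pose S k y := dyadic_Omega f k y.
have mart k y : (k < N)%N -> X k y = corner_mean (2 ^- k / 2) (X k.+1) y.
  move=> kN; rewrite /X /Omega_martingale.
  rewrite (_ : (N - k)%N = (N - k.+1).+1); last by lia.
  by rewrite /= exprS invfM mulrC.
have incr k y T : (k < N)%N ->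
    `|X k.+1 (y + (2 ^- k / 2) *: corner R T) - X k y| <= 3 * K.
  move=> kN; set z := y + _.
  have zy : `|z - y| <= 2 ^- k.
    rewrite /z addrC addKr normrZ.
    have s0 := exp2V_gt0 k; rewrite gtr0_norm ?divr_gt0//.
    have := norm_corner_le R T.
    have : 2 ^- k / 2 * `|corner R T| <= 2 ^- k / 2 * 1.
      by rewrite ler_wpM2l ?norm_corner_le// divr_ge0// ltW.
    lra.
  have h1 : `|X k.+1 z - S k.+1 z| <= K.
    by apply: approx => //; rewrite subrr normr0 ltW// exp2V_gt0.
  have h2 : `|X k y - S k z| <= K by apply: approx => //; exact: ltnW.
  have h3 : `|S k.+1 z - S k z| <= K.
    rewrite /S /dyadic_Omega (@Omega_itv_split _ _ _ _ _ (2 ^- k.+1) (2 ^- k))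
      ?exp2V_gt0 ?exp2V_le1 ?exp2V_le//.
    rewrite addrK; apply: short; first exact: exp2V_gt0.
    by rewrite exp2V_le//= exprS invfM mulrA divff// mul1r.
  move: h1 h2 h3; rewrite !ler_norml; lra.
have X0 : `|X 0 x| <= K.
  have := approx N 0 x x (leq0n _); rewrite subrr normr0 => /(_ _)/=.
  rewrite /dyadic_Omega expr0 invr1 /Omega_itv set_itv1 Rintegral_set1 subr0.
  exact.
have half (e : R) : `|e| = 1 ->
   (lebesgue_outer [set y | cube x (2 ^- 0) y /\
     exists m, (0 <= m <= N)%N /\ (lam + K < e * S m y)%R] <=
   (2 ^+ n.+1 * expR (t * (K - lam) + 2 * t ^+ 2 * (3 * K) ^+ 2 * N%:R))%:E)%E.
  move=> e1.
  apply: le_trans (@maximal_tree R n (fun m y => e * S m y) (fun m y => e * X m y)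
    N lam t (3 * K) K t0 tK _ _ _ N 0 x (add0n N)) _.
  - move=> k y kN; rewrite /corner_mean mart// /corner_mean mulrCA; congr (_ * _).
    by rewrite mulr_sumr.
  - by move=> k y T kN; rewrite -mulrBr normrM e1 mul1r incr.
  - move=> k y z kN yz; rewrite -lerBlDl -mulrBr (le_trans (ler_norm _))//.
    rewrite normrM e1 mul1r distrC approx//; exact: cube_norm.
  rewrite expr0 invr1 mulr1 lee_fin ler_wpM2l ?exprn_ge0// ler_expR lerD2r.
  rewrite ler_wpM2l// lerD2r (le_trans (ler_norm _))// normrM e1 mul1r//.
apply: (@le_trans _ _ (lebesgue_outer ([set y | cube x (2 ^- 0) y /\
     exists m, (0 <= m <= N)%N /\ (lam + K < 1 * S m y)%R] `|`
     [set y | cube x (2 ^- 0) y /\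
     exists m, (0 <= m <= N)%N /\ (lam + K < - 1 * S m y)%R]))).
  apply: le_lebesgue_outer => y [xy [m mN]]; rewrite -/(S m y) => lS.
  have xy' : cube x (2 ^- 0) y by rewrite expr0 invr1.
  have [S0|S0] := leP 0 (S m y); [left|right]; split => //; exists m; split => //.
    by move: lS; rewrite ger0_norm// mul1r.
  by move: lS; rewrite ltr0_norm// mulN1r.
apply: (le_trans (outer_measureU2 _ _ _)).
rewrite -mulrA mulr_natl mulr2n EFinD leeD// half ?normrN1 ?normr1//.
Qed.

End law_of_iterated_logarithm.

Section outer_null.
Context (R : realType) (n : nat).
Local Notation V := 'rV[R]_n.+1.

(** Borel-Cantelli, with 1 / k ^ 2 <= 1 / (k - 1) - 1 / k to bound the tails. *)
Lemma outer_limsup_null (F : nat -> set V) (E : set V) (c : R) : 0 <= c ->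
  (forall k, (4 <= k)%N -> (lebesgue_outer (F k) <= (c / k%:R ^+ 2)%:E)%E) ->
  (forall k0, (4 <= k0)%N -> E `<=` [set y | exists2 k, (k0 <= k)%N & F k y]) ->
  lebesgue_outer E = 0%E.
Proof.
move=> c0 Fc EF.
have bound N : (4 <= N)%N -> (lebesgue_outer E <= (c / N.-1%:R)%:E)%E.
  move=> N4.
  apply: (@le_trans _ _ (lebesgue_outer (\bigcup_(k in ~` `I_N) F k))).
    apply: le_lebesgue_outer => y /(EF N N4)[k Nk Fy]; exists k => //=.
    by apply/negP; rewrite -leqNgt.
  apply: (le_trans (outer_measure_sigma_subadditive_tail _ _ _)).
  apply: lime_le; first by apply: is_cvg_nneseries => k _ _; exact: outer_measure_ge0.
  near=> m.
  have Nm : (N <= m)%N by near: m; exists N.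
  apply: (@le_trans _ _ (\sum_(N <= k < m) (c / k.-1%:R - c / k%:R)%:E)%E).
    rewrite !big_nat; apply: lee_sum => k /andP[Nk _].
    have k4 : (4 <= k)%N by exact: leq_trans Nk.
    apply: (le_trans (Fc k k4)); rewrite lee_fin -mulrBr ler_wpM2l//.
    have kE : k%:R = k.-1%:R + 1 :> R by rewrite natr1 prednK// (leq_trans _ k4).
    have k0 : 0 < k.-1%:R :> R by rewrite ltr0n -subn1 subn_gt0 (leq_trans _ k4).
    rewrite kE; set q := k.-1%:R in k0 *.
    have -> : q^-1 - (q + 1)^-1 = (q * (q + 1))^-1.
      by field; apply/andP; split; lra.
    by rewrite lef_pV2 ?posrE ?expr2 ?mulr_gt0 ?ler_pM2r//; lra.
  rewrite sumEFin lee_fin.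
  have -> : \sum_(N <= k < m) (c / k.-1%:R - c / k%:R) =
     - \sum_(N <= k < m) (c / k.+1.-1%:R - c / k.-1%:R).
    by rewrite -sumrN; apply: eq_bigr => k _; rewrite opprB.
  rewrite (telescope_sumr (fun k => c / k.-1%:R))// opprB gerBl divr_ge0//.
apply/eqP; rewrite eq_le lebesgue_outer_ge0 andbT.
apply/lee_addgt0Pr => e e0; rewrite add0e.
have /archi_boundP := divr_ge0 c0 (ltW e0).
set k := Num.bound _ => hk.
have k0 : 0 < k%:R :> R by apply: le_lt_trans hk; rewrite divr_ge0// ltW.
apply: (le_trans (bound (k + 4)%N _)); first by rewrite leq_addl.
rewrite lee_fin addnS/= ler_pdivrMr; last by rewrite ltr0n addnS.
move: hk; rewrite ltr_pdivrMr// => /ltW /le_trans; apply.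
by rewrite mulrC ler_pM2l// ler_nat leq_addr.
Unshelve. all: by end_near. Qed.

End outer_null.

(** * The law of the iterated logarithm *)

Section logarithms.
Context (R : realType).

Lemma ln2_ge : 1 / 2 <= ln 2 :> R.
Proof.
rewrite -ler_expR lnK ?posrE// (le_trans (expR_le_quadratic _))//; lra.
Qed.

Lemma ln_exp2_ge m : m%:R / 2 <= ln (2 ^+ m) :> R.
Proof.
rewrite lnXn// -[leRHS]mulr_natl ler_wpM2l//.
by have := ln2_ge; rewrite mul1r.
Qed.

Lemma ln_nat_quarter k : (4 <= k)%N -> ln k%:R <= 2 ^+ k / 4 :> R.
Proof.
move=> k4; rewrite (@le_trans _ _ k%:R)//.
  by rewrite ltW// ln_sublinear// ltr0n (leq_trans _ k4).
rewrite ler_pdivlMr// -natrX -natrM ler_nat.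
elim: k k4 => // k IH; rewrite leq_eqVlt => /predU1P[<-//|k4].
by rewrite expnS; have := IH k4; lia.
Qed.

Lemma lnlnln_ge k m (z : R) : (7 <= k)%N -> (2 ^ k <= m)%N -> 2 ^+ m <= z ->
  2 ^+ k * ln k.+1%:R / 4 <= ln z * ln (ln (ln z)).
Proof.
move=> k7 km mz.
have z0 : 0 < z by apply: lt_le_trans mz; rewrite exprn_gt0.
have h1 : 2 ^+ k / 2 <= ln z.
  apply: (@le_trans _ _ (m%:R / 2)); first by rewrite ler_pM2r// -natrX ler_nat.
  by rewrite (le_trans (ln_exp2_ge m))// ler_ln ?posrE ?exprn_gt0.
have k1 : (k = k.-1.+1)%N by rewrite prednK// (leq_trans _ k7).
have h1' : 2 ^+ k.-1 <= ln z.
  by apply: le_trans h1; rewrite [in leRHS]k1 exprS mulrAC divff// mul1r.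
have lz0 : 0 < ln z by apply: lt_le_trans h1'; rewrite exprn_gt0.
have h2 : k.-1%:R / 2 <= ln (ln z).
  by rewrite (le_trans (ln_exp2_ge k.-1))// ler_ln ?posrE ?exprn_gt0.
have k6 : 6 <= k.-1%:R :> R by rewrite ler_nat; lia.
have llz0 : 0 < ln (ln z) by apply: lt_le_trans h2; lra.
have h3 : ln k.+1%:R / 2 <= ln (ln (ln z)).
  have : ln k.+1%:R <= ln ((k.-1%:R / 2) ^+ 2) :> R.
    rewrite ler_ln ?posrE ?exprn_gt0 ?ltr0n//; last by rewrite divr_gt0//; lra.
    rewrite {1}k1 -natr1 -natr1 expr2; nra.
  rewrite lnXn; last by rewrite divr_gt0//; lra.
  rewrite -[ln _ *+ 2]mulr_natl.
  have : ln (k.-1%:R / 2) <= ln (ln (ln z)).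
    by rewrite ler_ln ?posrE//; lra.
  lra.
have lk0 : 0 <= ln k.+1%:R :> R by rewrite ln_ge0// ler1n.
rewrite (_ : 2 ^+ k * _ / 4 = 2 ^+ k / 2 * (ln k.+1%:R / 2)); last by field.
by rewrite ler_pM// ?divr_ge0 ?exprn_ge0.
Qed.

Lemma dyadic_bracket (e : R) : 0 < e <= 1 ->
  exists m, 2 ^- m.+1 <= e <= 2 ^- m /\ 2 ^+ m <= e^-1 < 2 ^+ m.+1.
Proof.
move=> /andP[e0 e1].
have ei1 : 1 <= e^-1 by rewrite -invr1 lef_pV2 ?posrE.
have /andP[t1 t2] := truncn_itv (le_trans ler01 ei1).
set q := Num.truncn e^-1 in t1 t2.
have q0 : (0 < q)%N.
  by rewrite lt0n; apply/eqP => q0; rewrite q0 in t2; lra.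
have /andP[m1 m2] := trunc_log_bounds (isT : (1 < 2)%N) q0.
set m := trunc_log 2 q in m1 m2.
have b1 : 2 ^+ m <= e^-1 by rewrite (le_trans _ t1)// -natrX ler_nat.
have b2 : e^-1 < 2 ^+ m.+1.
  by rewrite (lt_le_trans t2)// -natrX ler_nat.
exists m; split; last by rewrite b1 b2.
rewrite -[e]invrK lef_pV2 ?posrE ?exprn_gt0 ?invr_gt0// (ltW b2)/=.
by rewrite lef_pV2 ?posrE ?exprn_gt0 ?invr_gt0.
Qed.

End logarithms.

Section iterated_logarithm.
Context (R : realType) (n p : nat).
Local Notation V := 'rV[R]_n.+1.
Variables (a : 'I_p -> V) (mu : 'I_p -> R).
Implicit Types (f : V -> R) (x y : V).

(** Four times the increment bound 3 * K: the exponent of the maximal inequality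
    then becomes - 4 ln k + 2 ln k, up to a constant, and exp (- 2 ln k) is
    summable. *)
Definition lil_level (K : R) k : R := 12 * K * Num.sqrt (2 ^+ k * ln k%:R).

Lemma lil_tail f (K : R) x k : 0 < K -> continuous f ->
  (forall lo hi x, 0 < lo -> lo <= hi <= 2 * lo -> `|Omega_itv a mu lo hi f x| <= K) ->
  (forall N k x y, (k <= N)%N -> `|y - x| <= 2 ^- k ->
     `|Omega_martingale a mu f N k x - dyadic_Omega a mu f k y| <= K) ->
  (4 <= k)%N ->
  (lebesgue_outer (large_Omega a mu f x (2 ^ k) (lil_level K k + K)%R) <=
    (2 * 2 ^+ n.+1 * expR 1 / k%:R ^+ 2)%:E)%E.
Proof.
move=> K0 cf short approx k4.
have k0 : 0 < k%:R :> R by rewrite ltr0n (leq_trans _ k4).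
have L0 : 0 <= ln k%:R :> R by rewrite ln_ge0// ler1n (leq_trans _ k4).
have Lk := @ln_nat_quarter R _ k4.
pose q : R := Num.sqrt (ln k%:R / 2 ^+ k).
have k20 : 0 < 2 ^+ k :> R by rewrite exprn_gt0.
have q0 : 0 <= q by exact: sqrtr_ge0.
have qq : q ^+ 2 = ln k%:R / 2 ^+ k by rewrite sqr_sqrtr// divr_ge0// ltW.
have q2 : q <= 1 / 2.
  rewrite -(@ler_sqr _ q) ?nnegrE// ?divr_ge0// qq ler_pdivrMr//; lra.
have K3 : 3 * K != 0 by rewrite gt_eqF// mulr_gt0.
(* This t minimizes the exponent - t * lil_level K k + 2 * (t * 3 * K) ^ 2 * 2 ^ k. *)
pose t := q / (3 * K).
have t0 : 0 <= t by rewrite divr_ge0// mulr_ge0// ltW.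
have tK : t * (3 * K) = q by rewrite /t divfK.
have tK2 : t * (3 * K) <= 1 / 2 by rewrite tK.
apply: (le_trans (dyadic_Omega_tail _ _ _ K0 cf short approx t0 tK2)).
rewrite lee_fin -[leRHS]mulrA ler_pM2l; last by rewrite mulr_gt0 ?exprn_gt0.
have -> : expR 1 / k%:R ^+ 2 = expR (1 - 2 * ln k%:R) :> R.
  by rewrite expRD expRN expRM_natl lnK.
rewrite ler_expR.
have e1 : t * lil_level K k = 4 * ln k%:R.
  have -> : t * lil_level K k =
      4 * (t * (3 * K)) * Num.sqrt (2 ^+ k * ln k%:R).
    by rewrite /lil_level; ring.
  rewrite tK -mulrA /q -sqrtrM ?divr_ge0 ?(ltW k20)// mulrA divfK ?gt_eqF//.
  by rewrite -expr2 sqrtr_sqr ger0_norm.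
have e2 : 2 * t ^+ 2 * (3 * K) ^+ 2 * (2 ^ k)%:R = 2 * ln k%:R.
  rewrite -(mulrA 2) -exprMn tK qq natrX -mulrA divfK ?gt_eqF//.
have e3 : t * K = q / 3 by rewrite -tK; field.
rewrite mulrBr e1 e2 e3; lra.
Qed.

(** For 2 ^ k <= m < 2 ^ k.+1 and eps between 2 ^- m.+1 and 2 ^- m, replacing eps
    by 2 ^- m costs K, replacing m by 2 ^ k.+1 in the level costs a factor
    sqrt 2, and the normalization is at least sqrt (2 ^ k * ln k.+1) / 2. *)
Lemma lil_limsup f (K : R) x k0 : 0 < K -> continuous f ->
  (forall lo hi x, 0 < lo -> lo <= hi <= 2 * lo -> `|Omega_itv a mu lo hi f x| <= K) ->
  (forall k m, (k0 <= k)%N -> (m <= 2 ^ k)%N ->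
     `|dyadic_Omega a mu f m x| <= lil_level K k + K) ->
  (limf_esup (fun eps : R =>
     (`|Omega a mu f eps x| / Num.sqrt (ln eps^-1 * ln (ln (ln eps^-1))))%:E)
     (0 : R)^'+ <= (40 * K)%:E)%E.
Proof.
move=> K0 cf short good.
pose k1 := maxn k0 7; pose e0 : R := 2 ^- (2 ^ k1).
have e0_gt0 : 0 < e0 by rewrite invr_gt0 exprn_gt0.
have e0_le1 : e0 <= 1 by exact: exp2V_le1.
apply: (@le_trans _ _ (ereal_sup [set (`|Omega a mu f eps x| /
    Num.sqrt (ln eps^-1 * ln (ln (ln eps^-1))))%:E | eps in [set e | 0 < e <= e0]])).
  apply: ereal_inf_lbound; exists [set e | 0 < e <= e0] => //.
  exists e0 => //= e /=; rewrite sub0r normrN => ee e_gt0.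
  by rewrite e_gt0 ltW//; move: ee; rewrite gtr0_norm.
apply: ge_ereal_sup => _ [e /andP[e_gt0 ee0] <-]; rewrite lee_fin.
have e1 : 0 < e <= 1 by rewrite e_gt0 (le_trans ee0).
have [m [/andP[m1 m2] /andP[m3 m4]]] := dyadic_bracket e1.
have k1m : (2 ^ k1 <= m)%N.
  have : 2 ^+ (2 ^ k1) < 2 ^+ m.+1 :> R.
    by apply: le_lt_trans m4; rewrite -[leLHS]invrK lef_pV2 ?posrE ?invr_gt0.
  by rewrite ltr_eXn2l ?ltr1n// ltnS.
have m0 : (0 < m)%N by apply: leq_trans k1m; rewrite expn_gt0.
have /andP[km mk] := trunc_log_bounds (isT : (1 < 2)%N) m0.
set k := trunc_log 2 m in km mk.
have k1k : (k1 <= k)%N by exact: trunc_log_max.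
have k7 : (7 <= k)%N by rewrite (leq_trans _ k1k)// leq_maxr.
have k0k : (k0 <= k.+1)%N by rewrite ltnW// ltnS (leq_trans _ k1k)// leq_maxl.
have hS := good _ _ k0k (ltnW mk).
have hO : `|Omega a mu f e x| <= lil_level K k.+1 + 2 * K.
  rewrite Omega_itvE (@Omega_itv_split _ _ _ _ _ e (2 ^- m)) ?m2 ?exp2V_le1//.
  have h : `|Omega_itv a mu e (2 ^- m) f x| <= K.
    apply: short => //; rewrite m2/=.
    by move: m1; rewrite exprS invfM ler_pdivrMl.
  have := ler_normD (Omega_itv a mu e (2 ^- m) f x) (dyadic_Omega a mu f m x).
  by rewrite {2}/dyadic_Omega; lra.
have hL := lnlnln_ge k7 km m3.
pose Q := Num.sqrt (2 ^+ k * ln k.+1%:R : R).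
have l1 : 1 <= ln k.+1%:R :> R.
  have h : ln (2 ^+ 2) <= ln k.+1%:R :> R.
    by rewrite ler_ln ?posrE ?exprn_gt0// -natrX ler_nat (leq_trans _ (leqW k7)).
  by have := @ln_exp2_ge R 2; lra.
have Q1 : 1 <= Q.
  rewrite -[leLHS]sqrtr1 ler_wsqrtr// -[leLHS]mulr1 ler_pM//.
  by rewrite exprn_ege1// ler1n.
have lQ : lil_level K k.+1 <= 18 * K * Q.
  have -> : lil_level K k.+1 = 12 * (K * Q * Num.sqrt 2).
    by rewrite /lil_level exprS -(mulrA 2) sqrtrM// -/Q; ring.
  have q2 : Num.sqrt 2 <= 3 / 2 :> R.
    by rewrite -(@ler_sqr _ (Num.sqrt 2)) ?nnegrE// ?divr_ge0// sqr_sqrtr//; lra.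
  have KQ : 0 <= K * Q by rewrite mulr_ge0 ?(ltW K0)// (le_trans ler01).
  have : K * Q * Num.sqrt 2 <= K * Q * (3 / 2) by rewrite ler_wpM2l.
  lra.
have QD : Q / 2 <= Num.sqrt (ln e^-1 * ln (ln (ln e^-1))).
  apply: le_trans (ler_wsqrtr hL).
  rewrite sqrtrM ?mulr_ge0 ?exprn_ge0 ?ln_ge0 ?ler1n// -/Q.
  rewrite sqrtrV// (_ : 4 = 2 ^+ 2) ?sqrtr_sqr ?ger0_norm//.
  by rewrite -natrX.
set D := Num.sqrt _ in QD *.
have D0 : 0 < D by apply: lt_le_trans QD; lra.
rewrite ler_pdivrMr// (le_trans hO)//.
have h1 : K * 1 <= K * Q by rewrite ler_pM2l.
have h2 : 40 * K * (Q / 2) <= 40 * K * D by rewrite ler_wpM2l// mulr_ge0// ltW.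
lra.
Qed.

End iterated_logarithm.

Section almost_everywhere.
Context (R : realType) (n : nat).
Local Notation V := 'rV[R]_n.+1.

Lemma outer_null_negligible (A : set V) : lebesgue_outer A = 0%E ->
  (lebesgue_measure_rV R n).-negligible A.
Proof.
move=> A0; exists A; split => //.
apply: le_caratheodory_measurable => X.
rewrite [X in (X + _)%E](_ : _ = 0%E) ?add0e.
  by apply: le_lebesgue_outer => y [].
apply/eqP; rewrite eq_le lebesgue_outer_ge0 andbT -A0.
by apply: le_lebesgue_outer => y [].
Qed.

Lemma ae_of_unit_cubes (P : V -> Prop) :
  (forall x, lebesgue_outer [set y | cube x 1 y /\ ~ P y] = 0%E) ->
  {ae lebesgue_measure_rV R n, forall y : V, P y}.
Proof.
move=> H.
pose corner_of (k : nat) : V :=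
  if (unpickle k : option 'rV[int]_n.+1) is Some z then map_mx intr z else 0.
suff : (lebesgue_measure_rV R n).-negligible
    (\bigcup_k [set y | cube (corner_of k) 1 y /\ ~ P y]).
  apply: negligibleS.
  move=> y /= nP; pose z : 'rV[int]_n.+1 := \row_i Num.floor (y ord0 i).
  exists (pickle z) => //; split => // i.
  rewrite /corner_of pickleK !mxE floor_le /=.
  by have := floorD1_gt (y ord0 i); rewrite intrD.
apply: negligible_bigcup => k; apply: outer_null_negligible; exact: H.
Qed.

End almost_everywhere.

(* The constant C is chosen after the dimension d.+1, the a i, the mu i and
   the value M of the Zygmund norm, and before f. *)
Theorem corollary1p2 (R : realType) (d p : nat)
    (a : 'I_p -> 'rV[R]_d.+1) (mu : 'I_p -> R)
    (hmu : \sum_(i < p) mu i = 0)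
    (hmua : \sum_(i < p) mu i *: a i = 0)
    (M : R) :
  exists C : R, 0 < C /\
    forall f : 'rV[R]_d.+1 -> R,
      zygmund_class f -> zygmund_norm f = M%:E ->
      {ae lebesgue_measure_rV R d, forall x : 'rV[R]_d.+1,
        (limf_esup (fun eps : R =>
           (`|Omega a mu f eps x|
              / Num.sqrt (ln eps^-1 * ln (ln (ln eps^-1))))%:E)
          (0 : R)^'+ <= C%:E)%E}.
Proof.
have M0 : 0 <= `|M| * Num.sqrt d.+1%:R by rewrite mulr_ge0// sqrtr_ge0.
have [K K0 HK] := Omega_martingale_approx hmu hmua M0.
exists (40 * K); split; first by rewrite mulr_gt0.
move=> f [cf _] /zygmund_norm_le fM.
have [short approx] := HK f cf fM.
apply: ae_of_unit_cubes => x.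
apply: (@outer_limsup_null _ _
    (fun k => large_Omega a mu f x (2 ^ k) (lil_level K k + K)) _
    (2 * 2 ^+ d.+1 * expR 1)).
- by rewrite mulr_ge0 ?expR_ge0// mulr_ge0// exprn_ge0.
- by move=> k k4; exact: lil_tail.
move=> k0 _ y /= [xy nP]; apply: contrapT => nF; apply: nP.
apply: (@lil_limsup _ _ _ _ _ _ _ _ k0) => // k m k0k mk.
rewrite leNgt; apply/negP => lS; apply: nF; exists k => //; split => //.
by exists m.
Qed.
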